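(* (a) The function $$\psi:\ \gamma\mapsto\min\{\xi_3(f):\ f\in\mathcal B_{[-1,1]},\ f(\gamma)=0\}$$ is well-defined on $(\tfrac12,\alpha_3)$. It is continuous, decreasing, and satisfies $$\lim_{t\to\frac12+}\psi(t)=1,\qquad \lim_{t\to\alpha_3-}\psi(t)=\alpha_3.$$ (b) For every $\gamma\in(\tfrac12,\alpha_3)$ we have $$\gamma<\lambda<\psi(\gamma)\ \Longrightarrow\ (\gamma,\lambda)\notin\widetilde\Omega_+.$$ (c) For every $\gamma\in(\tfrac12,\alpha_3)$ there exists a unique $( ** )$-function of the form $$H_{k,\ell}^{(a,b)}(x)=1-\sum_{i=1}^{k-1}x^i+ax^k+\sum_{i=k+1}^{\ell-1}x^i+bx^\ell-\frac{x^{\ell+1}}{1-x}\in\mathcal B_{[-1,1]}$$ (with integers $1\le k<\ell$ and $a,b\in[-1,1]$) such that $$H_{k,\ell}^{(a,b)}(\gamma)=H_{k,\ell}^{(a,b)}(\psi(\gamma))=(H_{k,\ell}^{(a,b)})'(\psi(\gamma))=0.$$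
   Context: $\mathcal B_{[-1,1]}=\{1+\sum_{n=1}^\infty a_nz^n:\ a_n\in[-1,1]\}$, a set of power series (convergent in the open unit disk). For a power series $f$ with bounded real coefficients, $\xi_1(f)\le\xi_2(f)\le\ldots$ denote its zeros in $(0,1)$ in increasing order, counted with multiplicity; by convention $\xi_k(f)=1$ if $f$ has fewer than $k$ zeros in $(0,1)$. $\widetilde\Omega_+=\{(\gamma,\lambda):\ 0<\gamma<\lambda<1\text{ and there is } f\in\mathcal B_{[-1,1]}\text{ with } f(\gamma)=f(\lambda)=0\text{ and }\xi_3(f)\le\lambda\}$. $\alpha_3$ is the smallest $x\in(0,1)$ that is a zero of multiplicity at least $3$ of some power series in $\mathcal B_{[-1,1]}$. It is known that $\alpha_3\approx0.727883$. A $( ** )$-function is a power series $h(x)=1+\sum_{n\ge1}a_nx^n$ for which there are integers $1\le\ell_1<\ell_2$ such that $a_n=-1$ for $1\le n\le\ell_1-1$, $a_n=1$ for $\ell_1+1\le n\le\ell_2-1$, $a_n=-1$ for $n\ge\ell_2+1$, the coefficients $a_{\ell_1},a_{\ell_2}$ are arbitrary real numbers, and the sequence of coefficients of $h$ has exactly three sign changes. Uniqueness in (c) is uniqueness as a function (power series). *)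

(* Defs.v *)
(* Stdlib reals with Coquelicot.  A power series is its coefficient sequence
   c : nat -> R; the function it defines is PSeries c. *)
From Stdlib Require Import Reals Lra Lia List.
From Coquelicot Require Import Coquelicot.
Open Scope R_scope.

Definition in_B (c : nat -> R) : Prop :=
  c 0%nat = 1 /\ forall n, (1 <= n)%nat -> -1 <= c n <= 1.

Definition is_minimum (E : R -> Prop) (m : R) : Prop :=
  E m /\ forall x, E x -> m <= x.

Definition zero_mult_ge (f : R -> R) (x : R) (m : nat) : Prop :=
  forall j, (j < m)%nat -> Derive_n f j x = 0.

(* m = 0 means that x is not a zero. *)
Definition zero_mult (f : R -> R) (x : R) (m : nat) : Prop :=
  zero_mult_ge f x m /\ Derive_n f m x <> 0.

(* xi 1 <= xi 2 <= ... lists the zeros of f in (0,1), each x repeated as many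
   times as its multiplicity, and takes the value 1 once the zeros (if finitely
   many) are exhausted.  These conditions determine xi k for k >= 1; the value
   xi 0 is irrelevant. *)
Definition zero_enumeration (f : R -> R) (xi : nat -> R) : Prop :=
  (forall k, (1 <= k)%nat -> 0 < xi k <= 1) /\
  (forall i j, (1 <= i <= j)%nat -> xi i <= xi j) /\
  (forall x, 0 < x < 1 ->
     exists l : list nat,
       NoDup l /\
       (forall k, In k l <-> ((1 <= k)%nat /\ xi k = x)) /\
       zero_mult f x (length l)).

Definition is_xi (k : nat) (f : R -> R) (x : R) : Prop :=
  exists xi, zero_enumeration f xi /\ xi k = x.

Definition Omega_tilde_plus (gamma lambda : R) : Prop :=
  0 < gamma /\ gamma < lambda /\ lambda < 1 /\
  exists c, in_B c /\ PSeries c gamma = 0 /\ PSeries c lambda = 0 /\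
    exists x, is_xi 3 (PSeries c) x /\ x <= lambda.

Definition is_alpha3 : R -> Prop :=
  is_minimum (fun x => 0 < x < 1 /\
                       exists c, in_B c /\ zero_mult_ge (PSeries c) x 3).

Definition xi3_values (gamma x : R) : Prop :=
  exists c, in_B c /\ PSeries c gamma = 0 /\ is_xi 3 (PSeries c) x.

(* Zero coefficients are skipped: only indices carrying nonzero coefficients of
   strictly alternating signs are selected. *)
Definition sign_changes_ge (c : nat -> R) (r : nat) : Prop :=
  exists n : nat -> nat, forall i, (i < r)%nat ->
    (n i < n (S i))%nat /\ c (n i) * c (n (S i)) < 0.

Definition sign_changes (c : nat -> R) (r : nat) : Prop :=
  sign_changes_ge c r /\ ~ sign_changes_ge c (S r).

Definition starstar (c : nat -> R) : Prop :=
  c 0%nat = 1 /\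
  (exists l1 l2 : nat, (1 <= l1 < l2)%nat /\
    (forall n, (1 <= n < l1)%nat -> c n = -1) /\
    (forall n, (l1 < n < l2)%nat -> c n = 1) /\
    (forall n, (l2 < n)%nat -> c n = -1)) /\
  sign_changes c 3.

(* sum_n_m u p q is 0 when p > q, as for k = 1 or l = k + 1 below. *)
Definition H (k l : nat) (a b x : R) : R :=
  1 - sum_n_m (fun i => x ^ i) 1 (k - 1) + a * x ^ k
    + sum_n_m (fun i => x ^ i) (k + 1) (l - 1) + b * x ^ l
    - x ^ (l + 1) / (1 - x).

Definition starstar_solution (gamma mu : R) (h : nat -> R) : Prop :=
  in_B h /\ starstar h /\
  exists (k l : nat) (a b : R),
    (1 <= k < l)%nat /\ -1 <= a <= 1 /\ -1 <= b <= 1 /\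
    (forall x, -1 < x < 1 -> PSeries h x = H k l a b x) /\
    H k l a b gamma = 0 /\ H k l a b mu = 0 /\ Derive (H k l a b) mu = 0.

(* Main.v *)
(** Vanishing at p is divisibility by 1 - x/p, and dividing a bounded coefficient
    sequence by such a factor lowers its number of sign changes.  For p, s, t in
    (0,1) there is a unique series with coefficients -1, then 1, then -1 after the
    constant term (with two exceptional coefficients in [-1,1]) that vanishes at
    p, s, t.  Its constant term cmax p s t is the largest possible: if f competes
    with it, the difference has at most two sign changes but three zeros.  Hence
    some f in B vanishes at p, s, t iff cmax p s t >= 1, and sign counting also
    shows that cmax is strictly increasing in each zero; exchanging a factor
    1 - x/p for 1 - x/p' shows that it is continuous.  So cmax equals 1 at
    (alpha3, alpha3, alpha3), psi(gamma) is the solution x of cmax gamma x x = 1,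
    and the extremal series at (gamma, psi(gamma), psi(gamma)) is the
    double-star function of (c). *)

Require Import Defs.
From Stdlib Require Import Reals Ranalysis5 Lra Lia List.
From Stdlib Require Import ClassicalEpsilon FunctionalExtensionality.
From Coquelicot Require Import Coquelicot.
Import ListNotations.
Open Scope R_scope.

(** * Descartes' rule of signs for power series *)

(** The three zeros may coincide, and they are not known to be distinct from one another. They are
    therefore encoded as divisibility by linear factors with a bounded quotient. Dually, they are
    three linear conditions whose weights are divided differences of x^n; both forms cover multiple
    zeros without cases. Counting signs gives uniqueness but not existence of the extremal series.
    With the constant term left free, one condition merely fixes that term. The other two are met by
    a window of coefficients 1 among coefficients -1: its mass for the first weight is kept at one
    half while it slides from one end to the other. The end positions give opposite patterns, so the
    second moment vanishes somewhere between. The endpoint 1/2 comes from the bound p / (1 - p) on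
    the coefficients of a quotient by 1 - x/p: at p = 1/2 it is 1, which keeps [cmax] below 1. For
    larger gamma an explicit series with three zeros shows that the value 1 is reached. *)

Definition bounded_seq (a : nat -> R) : Prop := exists M, forall n, Rabs (a n) <= M.

(* Coefficients of (1 - x / p) times the power series with coefficients q. *)
Definition mul_factor (p : R) (q : nat -> R) (n : nat) : R :=
  match n with O => q O | S m => q (S m) - q m / p end.

(* From index i on, the coefficients form at most r + 1 runs of alternating weak
   signs, the first run (possibly empty) having the sign of sg. *)
Fixpoint sign_pattern (r : nat) (sg : R) (i : nat) (a : nat -> R) : Prop :=
  match r with
  | O => forall n, (i <= n)%nat -> 0 <= sg * a n
  | S r' => exists k, (i <= k)%nat /\
      (forall n, (i <= n < k)%nat -> 0 <= sg * a n) /\ sign_pattern r' (- sg) k a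
  end.

Lemma pat_extend r sg i j a :
  (i <= j)%nat -> (forall n, (i <= n < j)%nat -> 0 <= sg * a n) ->
  sign_pattern r sg j a -> sign_pattern r sg i a.
Proof.
  intros Hij Hpos; destruct r as [|r]; simpl.
  - intros H n Hn. destruct (Nat.lt_ge_cases n j); auto.
  - intros [k [Hk [H1 H2]]]. exists k. split; [lia|split; [|exact H2]].
    intros n Hn. destruct (Nat.lt_ge_cases n j); [apply Hpos|apply H1]; lia.
Qed.

Lemma incr_to_zero_nonpos (u : nat -> R) (j : nat) :
  is_lim_seq u 0 -> (forall n, (j <= n)%nat -> u n <= u (S n)) ->
  forall n, (j <= n)%nat -> u n <= 0.
Proof.
  intros Hlim Hinc n Hn.
  assert (Hm : forall d, u n <= u (n + d)%nat).
  { induction d as [|d IH]; [rewrite Nat.add_0_r; lra|].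
    rewrite Nat.add_succ_r. eapply Rle_trans; [exact IH|apply Hinc; lia]. }
  assert (H := is_lim_seq_le_loc (fun _ => u n) u (u n) 0).
  simpl in H. apply H; [|apply is_lim_seq_const|exact Hlim].
  exists n. intros m Hnm. replace m with (n + (m - n))%nat by lia. apply Hm.
Qed.

(** Scaled by [p ^ n], the quotient's coefficients are the partial sums of the scaled product. Signs
    of the product thus become monotonicity of a sequence that tends to 0. *)
Lemma mul_scaled p q n : p <> 0 ->
  q (S n) * p ^ S n = q n * p ^ n + mul_factor p q (S n) * p ^ S n.
Proof. intros Hp; simpl; field; exact Hp. Qed.

Lemma bounded_scaled_lim p q : 0 < p < 1 -> bounded_seq q ->
  is_lim_seq (fun n => q n * p ^ n) 0.
Proof.
  intros Hp [M HM].
  assert (HG : is_lim_seq (fun n => M * p ^ n) 0).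
  { replace (Finite 0) with (Rbar_mult M 0) by (simpl; f_equal; ring).
    apply is_lim_seq_scal_l. apply is_lim_seq_geom. rewrite Rabs_pos_eq; lra. }
  apply is_lim_seq_abs_0.
  apply is_lim_seq_le_le with (u := fun _ => 0) (w := fun n => M * p ^ n);
    [|apply is_lim_seq_const|exact HG].
  intros n. split; [apply Rabs_pos|].
  rewrite Rabs_mult, (Rabs_pos_eq (p ^ n)) by (apply pow_le; lra).
  apply Rmult_le_compat_r; [apply pow_le; lra|apply HM].
Qed.

Section Division.
Variables (p : R) (q : nat -> R).
Hypothesis Hp : 0 < p < 1.
Hypothesis Hq : bounded_seq q.

Let S' (n : nat) := q n * p ^ n.

Lemma scaled_sign sg n : 0 <= sg * S' n <-> 0 <= sg * q n.
Proof.
  unfold S'. assert (0 < p ^ n) by (apply pow_lt; lra). split; intro H0.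
  - apply Rmult_le_reg_r with (p ^ n); lra.
  - rewrite <- Rmult_assoc. apply Rmult_le_pos; lra.
Qed.

Lemma scaled_step sg n : 0 <= sg * mul_factor p q (S n) -> sg * S' n <= sg * S' (S n).
Proof.
  intros H. unfold S'. rewrite mul_scaled by lra.
  assert (0 < p ^ S n) by (apply pow_lt; lra).
  assert (0 <= sg * mul_factor p q (S n) * p ^ S n) by (apply Rmult_le_pos; lra). lra.
Qed.

Lemma scaled_lim sg : is_lim_seq (fun n => sg * S' n) 0.
Proof.
  replace (Finite 0) with (Rbar_mult sg 0) by (simpl; f_equal; ring).
  apply is_lim_seq_scal_l. apply bounded_scaled_lim; assumption.
Qed.

Lemma div_nonpos sg i : (forall n, (i < n)%nat -> 0 <= sg * mul_factor p q n) ->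
  forall n, (i <= n)%nat -> sg * q n <= 0.
Proof.
  intros H n Hn. cut (0 <= - sg * q n); [lra|]. apply scaled_sign.
  cut (sg * S' n <= 0); [lra|].
  apply (incr_to_zero_nonpos (fun n => sg * S' n) i); [apply scaled_lim| |exact Hn].
  intros m Hm. apply scaled_step, H. lia.
Qed.

Lemma div_nonneg_run sg i k : 0 <= sg * q i ->
  (forall n, (i < n < k)%nat -> 0 <= sg * mul_factor p q n) ->
  forall n, (i <= n < k)%nat -> 0 <= sg * q n.
Proof.
  intros H0 H n [Hin Hnk].
  apply scaled_sign. apply scaled_sign in H0.
  induction n as [|n IH]; [replace i with 0%nat in * by lia; exact H0|].
  destruct (Nat.eq_dec i (S n)) as [->|Hne]; [exact H0|].
  eapply Rle_trans; [apply IH; lia|]. apply scaled_step, H; lia.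
Qed.

(** The scaled quotient moves in the direction given by the sign of the product. During a run
    directed towards 0 it either crosses, which accounts for one sign change, or keeps its sign, and
    then two changes of the product leave no trace. One change is always lost at the end: in the
    last run the quotient tends monotonically to 0, so it has the opposite sign throughout. *)
Lemma pat_div_from r : forall sg i, 0 <= sg * q i ->
  sign_pattern (S r) sg (S i) (mul_factor p q) -> sign_pattern r sg i q.
Proof.
  induction r as [r IHr] using (well_founded_induction Wf_nat.lt_wf).
  intros sg i H0 [k [Hk [Hup Hrest]]].
  assert (Hrun : forall n, (i <= n < k)%nat -> 0 <= sg * q n).
  { apply div_nonneg_run; [exact H0|]. intros n Hn. apply Hup; lia. }
  destruct r as [|r].
  - simpl in *. intros n Hn. destruct (Nat.lt_ge_cases n k); [apply Hrun; lia|].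
    cut (- sg * q n <= 0); [lra|].
    apply div_nonpos with (i := (k - 1)%nat); [|lia].
    intros m Hm. apply Hrest; lia.
  - destruct Hrest as [k2 [Hk2 [Hdown Hrest]]].
    (* Does the quotient reach 0 during the second run? The condition [k - 1 <= m] ensures that the
       product coefficients between [m] and [k2] belong to that run. *)
    destruct (classic (exists m, (i <= m < k2)%nat /\ sg * q m <= 0
        /\ (k - 1 <= m)%nat)) as [Hex|Hno].
    + assert (Hfirst : exists m, ((i <= m < k2)%nat /\ sg * q m <= 0 /\ (k - 1 <= m)%nat)
          /\ forall n, (k - 1 <= n < m)%nat -> 0 <= sg * q n).
      { destruct Hex as [m Hm].
        induction m as [m IHm] using (well_founded_induction Wf_nat.lt_wf).
        destruct (classic (exists m', (m' < m)%nat /\ (i <= m' < k2)%nat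
            /\ sg * q m' <= 0 /\ (k - 1 <= m')%nat)) as [[m' [H1 H2]]|Hn].
        - apply (IHm m'); assumption.
        - exists m. split; [exact Hm|]. intros n Hn'.
          destruct (Rle_lt_dec (sg * q n) 0); [|lra].
          exfalso. apply Hn. exists n. repeat split; try lia; assumption. }
      destruct Hfirst as [m [[Hm [Hqm Hkm]] Hbefore]].
      exists m. split; [lia|split].
      * intros n Hn. destruct (Nat.lt_ge_cases n k); [apply Hrun|apply Hbefore]; lia.
      * apply IHr; [lia|lra|]. exists k2. split; [lia|split].
        -- intros n Hn. apply Hdown; lia.
        -- exact Hrest.
    + assert (Hpos : forall n, (i <= n < k2)%nat -> 0 <= sg * q n).
      { intros n Hn. destruct (Nat.lt_ge_cases n (k - 1)); [apply Hrun; lia|].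
        destruct (Rle_lt_dec (sg * q n) 0); [|lra].
        exfalso. apply Hno. exists n. repeat split; try lia; assumption. }
      destruct r as [|r].
      (* The run starting at [k2] is the last one: the scaled quotient, times [sg], increases to 0
         from index [k2 - 1], so it is not positive there. *)
      * exfalso. apply Hno. exists (k2 - 1)%nat. repeat split; try lia.
        apply div_nonpos with (i := (k2 - 1)%nat); [|lia].
        intros m Hm. rewrite <- (Ropp_involutive sg). apply Hrest. lia.
      * assert (Hq' : sign_pattern r sg i q).
        { apply pat_extend with (k2 - 1)%nat; [lia|intros; apply Hpos; lia|].
          apply IHr; [lia|apply Hpos; lia|].
          replace (S (k2 - 1)) with k2 by lia.
          rewrite <- (Ropp_involutive sg). exact Hrest. }
        (* The uncrossed run removed two changes; two empty runs restore the count. *)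
        exists i. split; [lia|split; [intros; lia|]].
        exists i. split; [lia|split; [intros; lia|]].
        rewrite Ropp_involutive. exact Hq'.
Qed.

(** Product and quotient share their constant term, which supplies the starting sign for
    [pat_div_from]. An empty first run is passed over by switching to the opposite sign. *)
Lemma pat_div r : forall sg, sign_pattern (S r) sg 0 (mul_factor p q) -> sign_pattern r sg 0 q.
Proof.
  induction r as [|r IHr]; intros sg [k [_ [Hup Hrest]]]; destruct k as [|k].
  - simpl. intros n _. cut (- sg * q n <= 0); [lra|].
    apply div_nonpos with (i := 0%nat); [|lia]. intros m _. apply Hrest; lia.
  - apply pat_div_from; [apply (Hup 0%nat); lia|].
    exists (S k). split; [lia|split; [intros; apply Hup; lia|exact Hrest]].
  - exists 0%nat. split; [lia|split; [intros; lia|]]. apply IHr. exact Hrest.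
  - apply pat_div_from; [apply (Hup 0%nat); lia|].
    exists (S k). split; [lia|split; [intros; apply Hup; lia|exact Hrest]].
Qed.

(** The scaled quotient starts nonnegative and increases, yet it tends to 0. *)
Lemma nonneg_div_zero : (forall n, 0 <= mul_factor p q n) -> forall n, q n = 0.
Proof.
  intros H n.
  assert (H1 : 1 * q n <= 0).
  { apply div_nonpos with (i := 0%nat); [|lia]. intros m _. rewrite Rmult_1_l. apply H. }
  assert (H2 : 0 <= 1 * q n); [|lra].
  apply (div_nonneg_run 1 0 (S n)); [|intros m _; rewrite Rmult_1_l; apply H|lia].
  rewrite Rmult_1_l. apply (H 0%nat).
Qed.

End Division.

(** * Extremal bang-bang series *)

Lemma mul_comm p s q : mul_factor p (mul_factor s q) = mul_factor s (mul_factor p q).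
Proof.
  apply functional_extensionality; intros [|[|n]]; simpl; unfold Rdiv; ring.
Qed.

Lemma mul_minus p a b n : mul_factor p a n - mul_factor p b n = mul_factor p (fun m => a m - b m) n.
Proof. destruct n; simpl; unfold Rdiv; ring. Qed.

Lemma mul_scal p c a n : c * mul_factor p a n = mul_factor p (fun m => c * a m) n.
Proof. destruct n; simpl; unfold Rdiv; ring. Qed.

Lemma bounded_minus a b : bounded_seq a -> bounded_seq b -> bounded_seq (fun n => a n - b n).
Proof.
  intros [A HA] [B HB]. exists (A + B). intros n.
  eapply Rle_trans; [apply Rabs_triang|]. rewrite Rabs_Ropp.
  specialize (HA n); specialize (HB n); lra.
Qed.

Lemma bounded_scal c a : bounded_seq a -> bounded_seq (fun n => c * a n).
Proof.
  intros [A HA]. exists (Rabs c * A). intros n. rewrite Rabs_mult.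
  apply Rmult_le_compat_l; [apply Rabs_pos|apply HA].
Qed.

Lemma bounded_mul p q : bounded_seq q -> bounded_seq (mul_factor p q).
Proof.
  intros [M HM]. exists (M + M * Rabs (/ p)). intros n.
  assert (H0 := Rabs_pos (/ p)). assert (H1 := Rabs_pos (q 0%nat)).
  assert (HM0 := HM 0%nat).
  assert (0 <= M * Rabs (/ p)) by (apply Rmult_le_pos; lra).
  destruct n as [|n]; simpl; [lra|].
  eapply Rle_trans; [apply Rabs_triang|].
  unfold Rdiv. rewrite Rabs_Ropp, Rabs_mult.
  apply Rplus_le_compat; [apply HM|].
  apply Rmult_le_compat_r; [lra|apply HM].
Qed.

(** As a formal power series every sequence is divisible by these factors; boundedness of the
    quotient is what expresses the zeros, multiplicities included. *)
Definition vanishes (p s t : R) (a : nat -> R) : Prop :=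
  exists q, bounded_seq q /\ a = mul_factor p (mul_factor s (mul_factor t q)).

Lemma vanishes_swap12 p s t a : vanishes p s t a -> vanishes s p t a.
Proof. intros [q [Hq ->]]. exists q. split; [exact Hq|apply mul_comm]. Qed.

Lemma vanishes_swap23 p s t a : vanishes p s t a -> vanishes p t s a.
Proof. intros [q [Hq ->]]. exists q. split; [exact Hq|]. f_equal. apply mul_comm. Qed.

Lemma vanishes_minus p s t a b :
  vanishes p s t a -> vanishes p s t b -> vanishes p s t (fun n => a n - b n).
Proof.
  intros [q [Hq ->]] [r [Hr ->]]. exists (fun n => q n - r n).
  split; [apply bounded_minus; assumption|].
  apply functional_extensionality; intros n. rewrite mul_minus.
  f_equal. apply functional_extensionality; intros m. rewrite mul_minus.
  f_equal. apply functional_extensionality; intros m'. apply mul_minus.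
Qed.

Lemma vanishes_scal p s t c a :
  vanishes p s t a -> vanishes p s t (fun n => c * a n).
Proof.
  intros [q [Hq ->]]. exists (fun n => c * q n).
  split; [apply bounded_scal; assumption|].
  apply functional_extensionality; intros n. rewrite mul_scal.
  f_equal. apply functional_extensionality; intros m. rewrite mul_scal.
  f_equal. apply functional_extensionality; intros m'. apply mul_scal.
Qed.

Lemma vanishes_two_changes_zero p s t a :
  0 < p < 1 -> 0 < s < 1 -> 0 < t < 1 ->
  vanishes p s t a -> sign_pattern 2 1 0 a -> forall n, a n = 0.
Proof.
  intros Hp Hs Ht [q [Hq ->]] Ha.
  assert (H1 := pat_div p _ Hp (bounded_mul _ _ (bounded_mul _ _ Hq)) 1 1 Ha).
  assert (H2 := pat_div s _ Hs (bounded_mul _ _ Hq) 0 1 H1).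
  assert (H3 : forall n, q n = 0).
  { apply (nonneg_div_zero t q Ht Hq). intros n. rewrite <- (Rmult_1_l (mul_factor t q n)).
    apply H2. lia. }
  intros [|[|[|n]]]; simpl; rewrite !H3; unfold Rdiv; ring.
Qed.

(** A single coefficient always fits into one of the two neighbouring runs, so the signs of [a k]
    and [a l] are left open. *)
Lemma pat2_intro a k l : (k < l)%nat ->
  (forall n, (n < k)%nat -> 0 <= a n) -> (forall n, (k < n < l)%nat -> a n <= 0) ->
  (forall n, (l < n)%nat -> 0 <= a n) -> sign_pattern 2 1 0 a.
Proof.
  intros Hkl H1 H2 H3.
  assert (Hl : exists l', (l <= l' <= S l)%nat /\
      (forall n, (k < n < l')%nat -> a n <= 0) /\
      (forall n, (l' <= n)%nat -> 0 <= a n)).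
  { destruct (Rle_lt_dec (a l) 0).
    - exists (S l). split; [lia|split].
      + intros n Hn. destruct (Nat.eq_dec n l) as [->|]; [assumption|apply H2; lia].
      + intros n Hn. apply H3; lia.
    - exists l. split; [lia|split; [exact H2|]].
      intros n Hn. destruct (Nat.eq_dec n l) as [->|]; [lra|apply H3; lia]. }
  destruct Hl as [l' [Hl' [H2' H3']]].
  assert (Hk : exists k', (k <= k' <= S k)%nat /\
      (forall n, (n < k')%nat -> 0 <= a n) /\
      (forall n, (k' <= n < l')%nat -> a n <= 0)).
  { destruct (Rle_lt_dec 0 (a k)).
    - exists (S k). split; [lia|split].
      + intros n Hn. destruct (Nat.eq_dec n k) as [->|]; [assumption|apply H1; lia].
      + intros n Hn. apply H2'; lia.
    - exists k. split; [lia|split; [exact H1|]].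
      intros n Hn. destruct (Nat.eq_dec n k) as [->|]; [lra|apply H2'; lia]. }
  destruct Hk as [k' [Hk' [H1' H2'']]].
  exists k'. split; [lia|split; [intros n Hn; rewrite Rmult_1_l; apply H1'; lia|]].
  exists l'. split; [lia|split].
  - intros n Hn. specialize (H2'' n Hn). lra.
  - simpl. intros n Hn. specialize (H3' n Hn). lra.
Qed.

(** The constant term is left free because it is the quantity to be maximised. *)
Definition bang_bang (e : nat -> R) : Prop :=
  (forall n, (1 <= n)%nat -> -1 <= e n <= 1) /\
  exists k l : nat, (1 <= k < l)%nat /\
    (forall n, (1 <= n < k)%nat -> e n = -1) /\
    (forall n, (k < n < l)%nat -> e n = 1) /\
    (forall n, (l < n)%nat -> e n = -1).

Definition extremal (p s t : R) (e : nat -> R) : Prop :=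
  bang_bang e /\ vanishes p s t e.

Definition unit_tail (f : nat -> R) : Prop := forall n, (1 <= n)%nat -> -1 <= f n <= 1.

Lemma bang_bang_minus_pat f e :
  unit_tail f -> bang_bang e -> e 0%nat <= f 0%nat -> sign_pattern 2 1 0 (fun n => f n - e n).
Proof.
  intros Hf [_ [k [l [Hkl [E1 [E2 E3]]]]]] H0.
  apply pat2_intro with k l; [lia| | |].
  - intros [|n] Hn; [lra|]. rewrite E1 by lia. assert (H := Hf (S n)).
    assert (-1 <= f (S n) <= 1) by (apply Hf; lia). lra.
  - intros n Hn. rewrite E2 by lia. assert (-1 <= f n <= 1) by (apply Hf; lia). lra.
  - intros n Hn. rewrite E3 by lia. assert (-1 <= f n <= 1) by (apply Hf; lia). lra.
Qed.

(** Since equality of the constant terms is allowed, one sign count yields both maximality of [e]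
    and its uniqueness. *)
Lemma extremal_max p s t e f :
  0 < p < 1 -> 0 < s < 1 -> 0 < t < 1 ->
  extremal p s t e -> vanishes p s t f -> unit_tail f -> e 0%nat <= f 0%nat ->
  forall n, f n = e n.
Proof.
  intros Hp Hs Ht [He Ve] Vf Hf H0 n.
  assert (H := vanishes_two_changes_zero p s t _ Hp Hs Ht
    (vanishes_minus _ _ _ _ _ Vf Ve) (bang_bang_minus_pat f e Hf He H0) n).
  simpl in H. lra.
Qed.

(** A nonpositive constant term would merge with the first run of coefficients -1. Then [-e] would
    have at most two changes and three zeros, although its tail is 1. *)
Lemma extremal_pos p s t e :
  0 < p < 1 -> 0 < s < 1 -> 0 < t < 1 -> extremal p s t e -> 0 < e 0%nat.
Proof.
  intros Hp Hs Ht [[He [k [l [Hkl [E1 [E2 E3]]]]]] Ve].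
  destruct (Rlt_le_dec 0 (e 0%nat)) as [|H0]; [assumption|exfalso].
  assert (H := vanishes_two_changes_zero p s t _ Hp Hs Ht
    (vanishes_scal _ _ _ (-1) _ Ve)).
  specialize (H ltac:(apply pat2_intro with k l; [lia| | |];
    [intros [|n] Hn; [lra|rewrite E1 by lia; lra]
    |intros n Hn; rewrite E2 by lia; lra
    |intros n Hn; rewrite E3 by lia; lra]) (S l)).
  simpl in H. rewrite E3 in H by lia. lra.
Qed.

Lemma bang_bang_pat e : 0 <= e 0%nat -> bang_bang e -> sign_pattern 3 1 0 e.
Proof.
  intros H0 [_ [k [l [Hkl [E1 [E2 E3]]]]]].
  assert (Hp : sign_pattern 2 1 0 (fun n => match n with O => 0 | _ => - e n end)).
  { apply pat2_intro with k l; [lia| | |]; intros [|n] Hn; try lra; try lia.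
    - rewrite E1 by lia; lra.
    - rewrite E2 by lia; lra.
    - rewrite E3 by lia; lra. }
  destruct Hp as [k1 [_ [H1 [k2 [Hk2 [H2 H3]]]]]].
  exists 1%nat. split; [lia|split].
  { intros n Hn. replace n with 0%nat by lia. lra. }
  exists (Nat.max k1 1). split; [lia|split].
  { intros [|n] Hn; [lia|]. specialize (H1 (S n)). simpl in H1.
    assert (0 <= 1 * - e (S n)) by (apply H1; lia). lra. }
  exists (Nat.max k2 1). split; [lia|split].
  { intros [|n] Hn; [lia|]. specialize (H2 (S n)). simpl in H2.
    assert (0 <= - (1) * - e (S n)) by (apply H2; lia). lra. }
  intros [|n] Hn; [lia|]. specialize (H3 (S n)). simpl in H3.
  assert (0 <= - - (1) * - e (S n)) by (apply H3; lia). lra.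
Qed.

(** Three divisions use up the three sign changes. The nonnegative cofactor shows that an extremal
    series has no further zeros in (0,1). *)
Lemma extremal_quotient p s t e :
  0 < p < 1 -> 0 < s < 1 -> 0 < t < 1 -> extremal p s t e ->
  exists q, bounded_seq q /\ e = mul_factor p (mul_factor s (mul_factor t q)) /\ 0 < q 0%nat /\
    forall n, 0 <= q n.
Proof.
  intros Hp Hs Ht He. assert (H0 := extremal_pos p s t e Hp Hs Ht He).
  destruct He as [Hb [q [Hq ->]]].
  assert (H3 := bang_bang_pat _ (Rlt_le _ _ H0) Hb).
  assert (H2 := pat_div p _ Hp (bounded_mul _ _ (bounded_mul _ _ Hq)) 2 1 H3).
  assert (H1 := pat_div s _ Hs (bounded_mul _ _ Hq) 1 1 H2).
  assert (Hq0 := pat_div t _ Ht Hq 0 1 H1).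
  exists q. repeat split; [exact Hq|exact H0|].
  intros n. rewrite <- (Rmult_1_l (q n)). apply Hq0. lia.
Qed.

Lemma bounded_CV_radius a x : bounded_seq a -> -1 < x < 1 ->
  Rbar_lt (Rabs x) (CV_radius a).
Proof.
  intros [M HM] Hx.
  apply Rbar_lt_le_trans with 1; [simpl; apply Rabs_def1; lra|].
  apply CV_radius_bounded. exists M. intros n. rewrite pow1, Rmult_1_r. apply HM.
Qed.

Lemma bounded_ex_pseries a x : bounded_seq a -> -1 < x < 1 -> ex_pseries a x.
Proof.
  intros Ha Hx. apply CV_radius_inside, bounded_CV_radius; assumption.
Qed.

Lemma PSeries_mul p q x : bounded_seq q -> -1 < x < 1 ->
  PSeries (mul_factor p q) x = (1 - x / p) * PSeries q x.
Proof.
  intros Hq Hx.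
  rewrite (PSeries_ext (mul_factor p q) (PS_minus q (PS_scal (/ p) (PS_incr_1 q)))).
  - rewrite PSeries_minus, PSeries_scal, PSeries_incr_1.
    + unfold Rdiv; ring.
    + apply bounded_ex_pseries; assumption.
    + apply ex_pseries_scal; [apply Rmult_comm|].
      apply ex_pseries_incr_1, bounded_ex_pseries; assumption.
  - intros [|n]; unfold PS_minus, PS_plus, PS_opp, PS_scal, PS_incr_1, plus, opp, scal; simpl;
      unfold mult, zero; simpl; unfold Rdiv; ring.
Qed.

Lemma PSeries_nonneg a x : bounded_seq a -> 0 <= x < 1 -> (forall n, 0 <= a n) ->
  a 0%nat <= PSeries a x.
Proof.
  intros Ha Hx Hpos.
  assert (Hex : ex_pseries a x) by (apply bounded_ex_pseries; [assumption|lra]).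
  assert (Hs : is_lim_seq (sum_n (fun n => a n * x ^ n)) (PSeries a x)).
  { apply is_pseries_R, PSeries_correct, Hex. }
  apply (is_lim_seq_le (fun _ => a 0%nat) (sum_n (fun n => a n * x ^ n))
    (a 0%nat) (PSeries a x)); [|apply is_lim_seq_const|exact Hs].
  intros n. induction n as [|n IH].
  - rewrite sum_O. simpl. lra.
  - rewrite sum_Sn. unfold plus; simpl.
    assert (0 <= a (S n) * (x * x ^ n)); [|lra].
    apply Rmult_le_pos; [apply Hpos|]. apply Rmult_le_pos; [lra|apply pow_le; lra].
Qed.

(** Otherwise [e - e'] has at most two sign changes, and dividing by the shared factors at [s] and
    [t] leaves a nonnegative sequence [d]. At the smaller zero [p] the first half of [d] vanishes
    and the second contributes a negative value, a contradiction. *)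
Lemma extremal_mono p p' s t e e' :
  0 < p -> p < p' -> p' < 1 -> 0 < s < 1 -> 0 < t < 1 ->
  extremal p s t e -> extremal p' s t e' -> e 0%nat < e' 0%nat.
Proof.
  intros Hp0 Hpp Hp'1 Hs Ht He He'.
  assert (Hp : 0 < p < 1) by lra. assert (Hp' : 0 < p' < 1) by lra.
  destruct (Rlt_le_dec (e 0%nat) (e' 0%nat)) as [|Hle]; [assumption|exfalso].
  destruct (extremal_quotient p s t e Hp Hs Ht He) as [q [Hq [Eq [Hq0 Hqp]]]].
  destruct (extremal_quotient p' s t e' Hp' Hs Ht He') as [q' [Hq' [Eq' [Hq'0 Hq'p]]]].
  assert (Hpat := bang_bang_minus_pat e e' (proj1 (proj1 He)) (proj1 He') Hle).
  set (d := fun n => mul_factor p q n - mul_factor p' q' n).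
  assert (Hd : bounded_seq d) by (apply bounded_minus; apply bounded_mul; assumption).
  assert (Hdiff : (fun n => e n - e' n) = mul_factor s (mul_factor t d)).
  { rewrite Eq, Eq', (mul_comm p s), (mul_comm p t), (mul_comm p' s), (mul_comm p' t).
    apply functional_extensionality; intros n. rewrite mul_minus.
    f_equal. apply functional_extensionality; intros m. apply mul_minus. }
  rewrite Hdiff in Hpat.
  assert (H1 := pat_div s _ Hs (bounded_mul _ _ Hd) 1 1 Hpat).
  assert (H2 := pat_div t _ Ht Hd 0 1 H1).
  assert (Hdn : forall n, 0 <= d n).
  { intros n. rewrite <- (Rmult_1_l (d n)). apply H2. lia. }
  assert (HP : 0 <= PSeries d p).
  { eapply Rle_trans; [apply (Hdn 0%nat)|]. apply PSeries_nonneg; [exact Hd|lra|exact Hdn]. }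
  assert (HE : PSeries d p = PSeries (mul_factor p q) p - PSeries (mul_factor p' q') p).
  { rewrite <- PSeries_minus; [reflexivity| |];
      apply bounded_ex_pseries; try lra; apply bounded_mul; assumption. }
  rewrite HE, !PSeries_mul in HP by (assumption || lra).
  assert (HQ' : 0 < PSeries q' p).
  { eapply Rlt_le_trans; [exact Hq'0|]. apply PSeries_nonneg; [exact Hq'|lra|exact Hq'p]. }
  assert (0 < 1 - p / p').
  { cut (p / p' < 1); [lra|]. apply Rmult_lt_reg_r with p'; [lra|].
    unfold Rdiv. rewrite Rmult_assoc, Rinv_l by lra. lra. }
  assert (0 < (1 - p / p') * PSeries q' p) by (apply Rmult_lt_0_compat; assumption).
  replace (1 - p / p) with 0 in HP by (field; lra). lra.
Qed.

(** Reading the recurrence backwards, [K n = p * (K (S n) - c)] with [c] in [-1,1]. A bound [y] thus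
    improves to [p * (y + 1)], a contraction with fixed point [p / (1 - p)]. *)
Lemma quotient_bound p K : 0 < p < 1 -> bounded_seq K -> unit_tail (mul_factor p K) ->
  forall n, Rabs (K n) <= p / (1 - p).
Proof.
  intros Hp [M HM] Hf.
  assert (Hj : forall j n, Rabs (K n) <= p / (1 - p) + M * p ^ j).
  { induction j as [|j IH]; intros n.
    - assert (0 <= p / (1 - p)) by (apply Rlt_le, Rdiv_lt_0_compat; lra).
      specialize (HM n). simpl. lra.
    - assert (H1 : -1 <= mul_factor p K (S n) <= 1) by (apply Hf; lia). simpl in H1.
      replace (K n) with (p * (K (S n) - (K (S n) - K n / p))) by (field; lra).
      rewrite Rabs_mult, (Rabs_pos_eq p) by lra.
      replace (p / (1 - p) + M * p ^ S j)
        with (p * ((p / (1 - p) + M * p ^ j) + 1)) by (simpl; field; lra).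
      apply Rmult_le_compat_l; [lra|].
      eapply Rle_trans; [apply Rabs_triang|].
      apply Rplus_le_compat; [apply IH|]. rewrite Rabs_Ropp. apply Rabs_le; lra. }
  intros n.
  rewrite <- (Rplus_0_r (p / (1 - p))).
  apply (is_lim_seq_le (fun _ => Rabs (K n)) (fun j => p / (1 - p) + M * p ^ j)
    (Rabs (K n)) (p / (1 - p) + 0)); [intros j; apply Hj|apply is_lim_seq_const|].
  apply is_lim_seq_plus'; [apply is_lim_seq_const|].
  apply (bounded_scaled_lim p (fun _ => M) Hp). exists (Rabs M). intros _; lra.
Qed.

(* Trading the factor 1 - x / p for 1 - x / p' changes the coefficients by at
   most |1/p - 1/p'| p / (1 - p), and leaves the constant term alone. *)
Lemma extremal_move p p' s t e e' :
  0 < p < 1 -> 0 < p' < 1 -> 0 < s < 1 -> 0 < t < 1 ->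
  extremal p s t e -> extremal p' s t e' ->
  e 0%nat <= e' 0%nat * (1 + Rabs (/ p - / p') * (p / (1 - p))).
Proof.
  intros Hp Hp' Hs Ht [[He _] [q [Hq Eq]]] He'.
  set (K := mul_factor s (mul_factor t q)).
  assert (HK : bounded_seq K) by (do 2 apply bounded_mul; exact Hq).
  assert (HKb : forall n, Rabs (K n) <= p / (1 - p)).
  { apply quotient_bound; [exact Hp|exact HK|]. unfold K. rewrite <- Eq. exact He. }
  set (mu := 1 + Rabs (/ p - / p') * (p / (1 - p))).
  assert (Hmu : 1 <= mu).
  { unfold mu. assert (0 <= Rabs (/ p - / p') * (p / (1 - p))); [|lra].
    apply Rmult_le_pos; [apply Rabs_pos|apply Rlt_le, Rdiv_lt_0_compat; lra]. }
  set (f := fun n => / mu * mul_factor p' K n).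
  assert (Vf : vanishes p' s t f).
  { apply vanishes_scal. exists q. split; [exact Hq|reflexivity]. }
  assert (Hf : unit_tail f).
  { intros [|n] Hn; [lia|]. unfold f. apply Rabs_le_between.
    rewrite Rabs_mult, Rabs_pos_eq by (apply Rlt_le, Rinv_0_lt_compat; lra).
    apply Rmult_le_reg_l with mu; [lra|].
    rewrite <- Rmult_assoc, Rinv_r, Rmult_1_l, Rmult_1_r by lra.
    replace (mul_factor p' K (S n)) with (e (S n) + (/ p - / p') * K n)
      by (rewrite Eq; fold K; simpl; unfold Rdiv; ring).
    eapply Rle_trans; [apply Rabs_triang|]. unfold mu.
    apply Rplus_le_compat; [apply Rabs_le; apply He; lia|].
    rewrite Rabs_mult. apply Rmult_le_compat_l; [apply Rabs_pos|apply HKb]. }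
  assert (Hle : f 0%nat <= e' 0%nat).
  { destruct (Rle_lt_dec (f 0%nat) (e' 0%nat)) as [|Hlt]; [assumption|].
    rewrite (extremal_max p' s t e' f) ; try assumption; lra. }
  assert (E0 : e 0%nat = f 0%nat * mu).
  { unfold f. rewrite Eq. simpl. field. lra. }
  rewrite E0. apply Rmult_le_compat_r; lra.
Qed.

(** * Existence of extremal series *)

Lemma PSeries_bound a M x : (forall n, Rabs (a n) <= M) -> 0 <= x < 1 ->
  Rabs (PSeries a x) <= M / (1 - x).
Proof.
  intros HM Hx.
  assert (Hc : PSeries (fun _ => M) x = M / (1 - x)).
  { unfold PSeries. rewrite Series_scal_l, Series_geom; [reflexivity|].
    rewrite Rabs_pos_eq; lra. }
  assert (Ha : bounded_seq a) by (exists M; exact HM).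
  assert (HMb : bounded_seq (fun _ => M)) by (exists (Rabs M); intros; lra).
  assert (Hab : forall n, - M <= a n <= M) by (intros n; apply Rabs_le_between, HM).
  assert (H1 : 0 <= PSeries (PS_minus (fun _ => M) a) x).
  { eapply Rle_trans; [|apply PSeries_nonneg; [|lra|]].
    - unfold PS_minus, PS_plus, PS_opp, plus, opp; simpl. specialize (Hab 0%nat); lra.
    - apply bounded_minus; assumption.
    - intros n. unfold PS_minus, PS_plus, PS_opp, plus, opp; simpl. specialize (Hab n); lra. }
  assert (H2 : 0 <= PSeries (PS_plus (fun _ => M) a) x).
  { eapply Rle_trans; [|apply PSeries_nonneg; [|lra|]].
    - unfold PS_plus, plus; simpl. specialize (Hab 0%nat); lra.
    - exists (M + M). intros n. unfold PS_plus, plus; simpl.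
      apply Rabs_le. specialize (Hab n); lra.
    - intros n. unfold PS_plus, plus; simpl. specialize (Hab n); lra. }
  rewrite PSeries_minus in H1 by (apply bounded_ex_pseries; [assumption|lra]).
  rewrite PSeries_plus in H2 by (apply bounded_ex_pseries; [assumption|lra]).
  apply Rabs_le. lra.
Qed.

(** The quotient consists of the partial sums divided by [p ^ n]. Because the whole series sums to
    0, each partial sum is minus a tail, hence of order [p ^ n]. *)
Lemma mul_of_zero a p : 0 < p < 1 -> bounded_seq a -> PSeries a p = 0 ->
  exists K, bounded_seq K /\ a = mul_factor p K.
Proof.
  intros Hp [M HM] H0.
  exists (fun n => sum_f_R0 (fun j => a j * p ^ j) n / p ^ n). split.
  - exists (p * (M / (1 - p))). intros n.
    assert (Hpn : 0 < p ^ n) by (apply pow_lt; lra).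
    assert (H := PSeries_decr_n a n p
      (bounded_ex_pseries a p (ex_intro _ M HM) ltac:(lra))).
    rewrite H0 in H.
    replace (sum_f_R0 (fun j => a j * p ^ j) n / p ^ n)
      with (- (p * PSeries (PS_decr_n a (S n)) p)).
    + rewrite Rabs_Ropp, Rabs_mult, (Rabs_pos_eq p) by lra.
      apply Rmult_le_compat_l; [lra|]. apply PSeries_bound; [|lra].
      intros m. apply HM.
    + replace (sum_f_R0 (fun j => a j * p ^ j) n)
        with (- (p ^ S n * PSeries (PS_decr_n a (S n)) p)) by lra.
      simpl. field. lra.
  - apply functional_extensionality. intros [|n].
    + simpl. field.
    + assert (0 < p ^ n) by (apply pow_lt; lra).
      simpl. field. lra.
Qed.

(* [raise t chi n] is the sum of [t ^ (n - j) * chi j] over [j < n]; iterating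
   [raise] on a geometric sequence yields the divided differences of [x ^ n]. *)
Fixpoint raise (t : R) (chi : nat -> R) (n : nat) : R :=
  match n with O => 0 | S m => t * (raise t chi m + chi m) end.

Lemma raise_nonneg t chi : 0 < t -> (forall n, 0 <= chi n) -> forall n, 0 <= raise t chi n.
Proof.
  intros Ht Hc. induction n as [|n IH]; simpl; [lra|].
  apply Rmult_le_pos; [lra|]. specialize (Hc n). lra.
Qed.

Lemma raise_ex_series t chi : 0 < t < 1 -> (forall n, 0 <= chi n) ->
  ex_series chi -> ex_series (raise t chi).
Proof.
  intros Ht Hc [X HX].
  assert (Hsum : forall n, sum_n chi n <= X).
  { intros n. apply (is_lim_seq_incr_compare (sum_n chi) X); [exact HX|].
    intros m. rewrite sum_Sn. unfold plus; simpl. specialize (Hc (S m)). lra. }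
  assert (HX0 : 0 <= X).
  { eapply Rle_trans; [|apply (Hsum 0%nat)]. rewrite sum_O. apply Hc. }
  assert (Hrec : forall n, sum_n (raise t chi) (S n)
      = t * (sum_n (raise t chi) n + sum_n chi n)).
  { induction n as [|n IH].
    - rewrite sum_Sn, !sum_O. unfold plus; simpl. ring.
    - rewrite (sum_Sn _ (S n)), IH at 1. rewrite (sum_Sn _ n), (sum_Sn chi n).
      unfold plus; simpl. ring. }
  assert (Hb : forall n, sum_n (raise t chi) n <= t * X / (1 - t)).
  { induction n as [|n IH].
    - rewrite sum_O. simpl. apply Rmult_le_pos; [apply Rmult_le_pos; lra|].
      apply Rlt_le, Rinv_0_lt_compat; lra.
    - rewrite Hrec. replace (t * X / (1 - t)) with (t * (t * X / (1 - t) + X)) by (field; lra).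
      apply Rmult_le_compat_l; [lra|]. specialize (Hsum n). lra. }
  destruct (ex_finite_lim_seq_incr (sum_n (raise t chi)) (t * X / (1 - t))) as [l Hl].
  - intros n. rewrite sum_Sn. unfold plus; simpl.
    assert (H := raise_nonneg t chi ltac:(lra) Hc (S n)). simpl in H. lra.
  - exact Hb.
  - exists l. exact Hl.
Qed.

Lemma bounded_mul_lim b phi : bounded_seq b -> is_lim_seq phi 0 ->
  is_lim_seq (fun n => b n * phi n) 0.
Proof.
  intros [M HM] Hphi. apply is_lim_seq_abs_0.
  apply is_lim_seq_le_le with (u := fun _ => 0) (w := fun n => M * Rabs (phi n));
    [|apply is_lim_seq_const|].
  - intros n. split; [apply Rabs_pos|]. rewrite Rabs_mult.
    apply Rmult_le_compat_r; [apply Rabs_pos|apply HM].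
  - replace (Finite 0) with (Rbar_mult M 0) by (simpl; f_equal; ring).
    apply is_lim_seq_scal_l. exact (proj1 (is_lim_seq_abs_0 _) Hphi).
Qed.

(** Summation by parts: up to sign, [raise t] is adjoint to [mul_factor t]. A moment of the product
    against raised weights is thus a moment of the quotient against the original weights. *)
Lemma raise_transfer t b chi : 0 < t < 1 -> bounded_seq b ->
  (forall n, 0 <= chi n) -> ex_series chi ->
  is_series (fun n => mul_factor t b n * raise t chi n) 0 ->
  is_series (fun n => b n * chi n) 0.
Proof.
  intros Ht Hb Hc HX H0.
  assert (Htel : forall n, sum_n (fun m => b m * chi m) n
    = b (S n) * raise t chi (S n) - sum_n (fun m => mul_factor t b m * raise t chi m) (S n)).
  { induction n as [|n IH].
    - rewrite sum_Sn, !sum_O. unfold plus; simpl. field. lra.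
    - rewrite sum_Sn, IH, (sum_Sn (fun m => mul_factor t b m * raise t chi m) (S n)).
      unfold plus; simpl. field. lra. }
  change (is_lim_seq (sum_n (fun n => b n * chi n)) 0).
  apply is_lim_seq_ext with
    (fun n => b (S n) * raise t chi (S n)
      - sum_n (fun m => mul_factor t b m * raise t chi m) (S n)).
  { intros n. symmetry. apply Htel. }
  replace 0 with (0 - 0) by ring.
  apply is_lim_seq_minus'.
  - apply (is_lim_seq_incr_1 (fun n => b n * raise t chi n)).
    apply bounded_mul_lim; [exact Hb|].
    apply ex_series_lim_0, raise_ex_series; assumption.
  - apply (is_lim_seq_incr_1 (sum_n (fun m => mul_factor t b m * raise t chi m))). exact H0.
Qed.

Lemma ex_series_pow p : 0 < p < 1 -> ex_series (fun n => p ^ n).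
Proof. intros Hp. apply ex_series_geom. rewrite Rabs_pos_eq; lra. Qed.

Lemma PSeries_zero a p : is_series (fun n => a n * p ^ n) 0 -> PSeries a p = 0.
Proof. intros H. apply is_series_unique. exact H. Qed.

(** The first condition splits off the factor at [t]; the other two descend to the quotient, where
    the argument repeats with [s] and then [p]. *)
Lemma vanishes_of_moments p s t a :
  0 < p < 1 -> 0 < s < 1 -> 0 < t < 1 -> bounded_seq a ->
  is_series (fun n => a n * t ^ n) 0 ->
  is_series (fun n => a n * raise t (fun m => s ^ m) n) 0 ->
  is_series (fun n => a n * raise t (raise s (fun m => p ^ m)) n) 0 ->
  vanishes p s t a.
Proof.
  intros Hp Hs Ht Ha H0 H1 H2.
  assert (Hpow : forall x, 0 < x < 1 -> forall n, 0 <= x ^ n) by (intros; apply pow_le; lra).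
  destruct (mul_of_zero a t Ht Ha (PSeries_zero _ _ H0)) as [b [Hb ->]].
  apply raise_transfer in H1; [|assumption|assumption|auto|apply ex_series_pow; assumption].
  apply raise_transfer in H2; [|assumption|assumption
    |apply raise_nonneg; [lra|auto]
    |apply raise_ex_series; [assumption|auto|apply ex_series_pow; assumption]].
  destruct (mul_of_zero b s Hs Hb (PSeries_zero _ _ H1)) as [d [Hd ->]].
  apply raise_transfer in H2; [|assumption|assumption|auto|apply ex_series_pow; assumption].
  destruct (mul_of_zero d p Hp Hd (PSeries_zero _ _ H2)) as [q [Hq ->]].
  apply vanishes_swap12, vanishes_swap23, vanishes_swap12.
  exists q. split; [exact Hq|reflexivity].
Qed.

(** * Annihilating two moments with a sliding window *)

Section Balance.
Variables w v : nat -> R.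
Hypothesis w0 : w 0%nat = 0.
Hypothesis wpos : forall n, 0 < w (S n).
Hypothesis wex : ex_series w.
Hypothesis vpos : forall n, 0 <= v n.
Hypothesis vex : ex_series v.

Let W := Series w.
Let tail (n : nat) := W - sum_n w n.

Lemma tail_0 : tail 0 = W.
Proof. unfold tail. rewrite sum_O, w0. ring. Qed.

Lemma tail_S n : tail n = tail (S n) + w (S n).
Proof. unfold tail. rewrite sum_Sn. unfold plus; simpl. ring. Qed.

Lemma tail_lim : is_lim_seq tail 0.
Proof.
  unfold tail. replace 0 with (W - W) by ring.
  apply is_lim_seq_minus'; [apply is_lim_seq_const|]. apply (Series_correct w wex).
Qed.

Lemma tail_decr n m : (n <= m)%nat -> tail m <= tail n.
Proof.
  induction 1 as [|m H IH]; [lra|]. assert (H1 := tail_S m). specialize (wpos m). lra.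
Qed.

Lemma tail_pos n : 0 < tail n.
Proof.
  assert (H := tail_S n). assert (Hw := wpos n).
  assert (0 <= tail (S n)); [|lra].
  apply (is_lim_seq_le_loc tail (fun _ => tail (S n)) 0 (tail (S n)));
    [|apply tail_lim|apply is_lim_seq_const].
  exists (S n). intros m Hm. apply tail_decr, Hm.
Qed.

Lemma tail_below y : 0 < y <= W ->
  exists k, (1 <= k)%nat /\ tail k < y /\ forall n, (n < k)%nat -> y <= tail n.
Proof.
  intros Hy.
  assert (Hex : exists k, tail k < y).
  { destruct (proj2 (is_lim_seq_spec tail 0) tail_lim (mkposreal y (proj1 Hy))) as [k Hk].
    exists k. specialize (Hk k (le_n k)). simpl in Hk.
    apply Rabs_def2 in Hk. lra. }
  destruct Hex as [m Hm].
  induction m as [m IH] using (well_founded_induction Wf_nat.lt_wf).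
  destruct (classic (exists m', (m' < m)%nat /\ tail m' < y)) as [[m' [H1 H2]]|Hno].
  - apply (IH m'); assumption.
  - exists m. split; [|split; [exact Hm|]].
    + destruct m; [rewrite tail_0 in Hm; lra|lia].
    + intros n Hn. destruct (Rle_lt_dec y (tail n)); [assumption|].
      exfalso. apply Hno. exists n. split; assumption.
Qed.

(* The fraction of the weight w (S n) used when a total mass y is filled with
   the weights, starting from the ones of largest index. *)
Definition fill (y : R) (n : nat) : R :=
  (Rmin y (tail n) - Rmin y (tail (S n))) / w (S n).

Lemma fill_incr y y' n : y <= y' -> 0 <= fill y' n - fill y n <= 1.
Proof.
  intros Hy. assert (Ht := tail_S n). assert (Hw := wpos n).
  unfold fill.
  replace ((Rmin y' (tail n) - Rmin y' (tail (S n))) / w (S n)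
     - (Rmin y (tail n) - Rmin y (tail (S n))) / w (S n))
   with ((Rmin y' (tail n) - Rmin y' (tail (S n))
     - (Rmin y (tail n) - Rmin y (tail (S n)))) / w (S n)) by (field; lra).
  assert (0 <= Rmin y' (tail n) - Rmin y' (tail (S n))
     - (Rmin y (tail n) - Rmin y (tail (S n))) <= w (S n)).
  { unfold Rmin; repeat destruct Rle_dec; lra. }
  split.
  - apply Rmult_le_pos; [lra|apply Rlt_le, Rinv_0_lt_compat; lra].
  - apply Rmult_le_reg_r with (w (S n)); [lra|].
    unfold Rdiv. rewrite Rmult_assoc, Rinv_l by lra. lra.
Qed.

Lemma fill_0 y n : y <= tail (S n) -> fill y n = 0.
Proof.
  intros H. assert (Ht := tail_S n). assert (Hw := wpos n).
  unfold fill. rewrite !Rmin_left by lra. unfold Rdiv. ring.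
Qed.

Lemma fill_1 y n : tail n <= y -> fill y n = 1.
Proof.
  intros H. assert (Ht := tail_S n). assert (Hw := wpos n).
  unfold fill. rewrite !Rmin_right by lra. rewrite Ht. field. lra.
Qed.

Lemma fill_continuous n : continuity (fun y => fill y n).
Proof.
  assert (Hmin : forall A, continuity (fun y => Rmin y A)).
  { intros A y0 eps He. exists eps. split; [exact He|].
    intros y [_ Hy]. simpl in *. unfold R_dist in *.
    apply Rle_lt_trans with (Rabs (y - y0)); [|exact Hy].
    apply Rabs_le. unfold Rmin, Rabs; repeat destruct Rle_dec; destruct Rcase_abs; lra. }
  unfold fill. intros y. unfold Rdiv.
  apply continuity_pt_mult; [|apply continuity_pt_const; intros ? ?; reflexivity].
  apply continuity_pt_minus; apply Hmin.
Qed.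

(** The pattern is 1 on a window of [w]-mass [W / 2] and -1 outside it, where [y] is the mass beyond
    the window. Fractional coefficients at the two ends make it continuous in [y]. *)
Definition weights (y : R) (n : nat) : R :=
  match n with O => 0 | S m => -1 + 2 * (fill (y + W / 2) m - fill y m) end.

Lemma W_pos : 0 < W.
Proof. rewrite <- tail_0. apply tail_pos. Qed.

Lemma weights_bound y n : -1 <= weights y n <= 1.
Proof.
  assert (HW := W_pos). destruct n as [|n]; simpl; [lra|].
  assert (H := fill_incr y (y + W / 2) n). lra.
Qed.

Lemma fill_sum y n : Rmin y W - Rmin y (tail n)
  = sum_n (fun m => match m with O => 0 | S j => fill y j * w (S j) end) n.
Proof.
  induction n as [|n IH].
  - rewrite sum_O, tail_0. ring.
  - rewrite sum_Sn, <- IH. unfold plus; simpl. unfold fill.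
    assert (Hw := wpos n). field. lra.
Qed.

(** Wherever the window stands, it carries half of the total mass, so the sum is
    [- W + 2 * (W / 2)]. *)
Lemma weights_sum y : 0 <= y <= W / 2 -> is_series (fun n => weights y n * w n) 0.
Proof.
  intros Hy. assert (HW := W_pos).
  assert (Hs : forall n, - (sum_n w n) + 2 * (Rmin y (tail n) - Rmin (y + W / 2) (tail n) + W / 2)
    = sum_n (fun m => weights y m * w m) n).
  { intros n. symmetry.
    transitivity (- sum_n w n + 2 *
      (sum_n (fun m => match m with O => 0 | S j => fill (y + W/2) j * w (S j) end) n
       - sum_n (fun m => match m with O => 0 | S j => fill y j * w (S j) end) n)).
    - induction n as [|n IH]; [rewrite !sum_O, w0|].
      { change (@eq R (weights y 0 * 0) (- 0 + 2 * (0 - 0))). simpl; ring. }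
      rewrite !sum_Sn, IH. unfold plus; simpl.
      match goal with |- ?a = ?b => change (@eq R a b) end. ring.
    - rewrite <- !fill_sum, (Rmin_left y W), (Rmin_left (y + W / 2) W) by lra. ring. }
  change (is_lim_seq (sum_n (fun n => weights y n * w n)) 0).
  eapply is_lim_seq_ext; [intros n; apply Hs|].
  assert (Hmin : forall z, 0 <= z -> is_lim_seq (fun n => Rmin z (tail n)) 0).
  { intros z Hz. apply is_lim_seq_le_le with (u := fun _ => 0) (w := tail);
      [|apply is_lim_seq_const|apply tail_lim].
    intros n. assert (H := tail_pos n). unfold Rmin; destruct Rle_dec; lra. }
  replace (Finite 0) with (Finite (- W + 2 * (0 - 0 + W / 2))) by (f_equal; field).
  apply is_lim_seq_plus'.
  - apply is_lim_seq_opp with (l := W). apply (Series_correct w wex).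
  - apply (is_lim_seq_scal_l _ 2 (0 - 0 + W / 2)).
    apply is_lim_seq_plus'; [|apply is_lim_seq_const].
    apply is_lim_seq_minus'; apply Hmin; lra.
Qed.

Lemma weights_ex_series y : ex_series (fun n => weights y n * v n).
Proof.
  apply (ex_series_le (V := R_CompleteNormedModule) _ v); [|exact vex].
  intros n. unfold norm; simpl. unfold abs; simpl.
  rewrite Rabs_mult, (Rabs_pos_eq (v n)) by apply vpos.
  rewrite <- (Rmult_1_l (v n)) at 2.
  apply Rmult_le_compat_r; [apply vpos|apply Rabs_le, weights_bound].
Qed.

(** Weierstrass test: the finite sums are continuous in [y], and [v] dominates the terms
    uniformly. *)
Lemma moment_continuous : continuity (fun y => Series (fun n => weights y n * v n)).
Proof.
  intros y0.
  assert (H1 : 0 < 1) by lra.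
  apply CVU_continuity with
    (fn := fun N y => sum_n (fun n => weights y n * v n) N) (x := y0) (r := mkposreal 1 H1).
  - intros eps Heps.
    destruct (proj2 (is_lim_seq_spec (sum_n v) (Series v)) (Series_correct v vex)
      (mkposreal eps Heps)) as [N HN].
    exists N. intros n y Hn _.
    assert (Hex := weights_ex_series y).
    rewrite (Series_incr_n _ (S n)) by (lia || assumption).
    rewrite Nat.pred_succ, <- sum_n_Reals.
    match goal with |- Rabs (?A + ?B - ?A) < _ => replace (A + B - A) with B by ring end.
    specialize (HN n Hn). simpl in HN.
    rewrite (Series_incr_n v (S n)) in HN by (lia || assumption).
    rewrite Nat.pred_succ, <- sum_n_Reals in HN.
    eapply Rle_lt_trans; [|exact HN].
    match goal with |- _ <= Rabs (?A - (?A + ?B)) =>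
      replace (A - (A + B)) with (- B) by ring end.
    rewrite Rabs_Ropp. eapply Rle_trans; [|apply Rle_abs].
    assert (Hle : forall k, 0 <= Rabs (weights y (S n + k) * v (S n + k)%nat)
        <= v (S n + k)%nat).
    { intros k. split; [apply Rabs_pos|].
      rewrite Rabs_mult, (Rabs_pos_eq (v _)) by apply vpos.
      rewrite <- (Rmult_1_l (v (S n + k)%nat)) at 2.
      apply Rmult_le_compat_r; [apply vpos|apply Rabs_le, weights_bound]. }
    assert (Hv' : ex_series (fun k => v (S n + k)%nat)) by (apply ex_series_incr_n, vex).
    eapply Rle_trans; [apply Series_Rabs|apply Series_le; assumption].
    apply (ex_series_le (V := R_CompleteNormedModule) _ (fun k => v (S n + k)%nat));
      [|exact Hv'].
    intros k. unfold norm; simpl; unfold abs; simpl. rewrite Rabs_Rabsolu. apply Hle.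
  - intros N y _. induction N as [|N IH].
    + apply continuity_pt_ext with (f := fun _ => 0).
      * intros z. rewrite sum_O. simpl. ring.
      * apply continuity_pt_const. intros ? ?; reflexivity.
    + apply continuity_pt_ext with (f := fun z => sum_n (fun n => weights z n * v n) N
        + (-1 + 2 * (fill (z + W / 2) N - fill z N)) * v (S N)).
      * intros z. rewrite sum_Sn. reflexivity.
      * apply continuity_pt_plus; [exact IH|].
        apply continuity_pt_mult; [|apply continuity_pt_const; intros ? ?; reflexivity].
        apply continuity_pt_plus; [apply continuity_pt_const; intros ? ?; reflexivity|].
        apply continuity_pt_scal. apply continuity_pt_minus; [|apply fill_continuous].
        apply (continuity_pt_comp (fun z => z + W / 2) (fun z => fill z N));
          [|apply fill_continuous].
        apply continuity_pt_plus; [apply continuity_pt_id|].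
        apply continuity_pt_const; intros ? ?; reflexivity.
  - unfold Boule. simpl. rewrite Rminus_diag, Rabs_R0. lra.
Qed.

(** The windows for [y = 0] and [y = W / 2] are complementary, so the patterns are opposite and so
    are the two moments against [v]; the moment vanishes at some [y] between. *)
Lemma balanced_weights : exists a : nat -> R,
  (forall n, -1 <= a n <= 1) /\
  is_series (fun n => a n * w n) 0 /\ is_series (fun n => a n * v n) 0 /\
  exists k, (1 <= k)%nat /\ (forall n, (1 <= n < k)%nat -> a n = -1) /\
   ((forall n, (k < n)%nat -> a n = 1) \/
    exists l, (k < l)%nat /\ (forall n, (k < n < l)%nat -> a n = 1) /\
      (forall n, (l < n)%nat -> a n = -1)).
Proof.
  assert (HW := W_pos).
  assert (Hanti : forall n, weights (W / 2) n = - weights 0 n).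
  { intros [|n]; simpl; [ring|]. replace (W / 2 + W / 2) with W by field.
    rewrite Rplus_0_l, (fill_1 W), (fill_0 0); [ring| |].
    - apply Rlt_le, tail_pos.
    - rewrite <- tail_0. apply tail_decr. lia. }
  destruct (IVT_cor _ 0 (W / 2) moment_continuous ltac:(lra)) as [y [Hy H0]].
  { rewrite (Series_ext (fun n => weights (W / 2) n * v n)
      (fun n => -1 * (weights 0 n * v n))), Series_scal_l by (intros n; rewrite Hanti; ring).
    assert (H := Rle_0_sqr (Series (fun n => weights 0 n * v n))). unfold Rsqr in H. lra. }
  exists (weights y). split; [apply weights_bound|].
  split; [apply weights_sum; exact Hy|split].
  { rewrite <- H0. apply Series_correct, weights_ex_series. }
  destruct (tail_below (y + W / 2)) as [k [Hk [Hk1 Hk2]]]; [lra|].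
  exists k. split; [exact Hk|split].
  { intros [|n] Hn; [lia|]. simpl. rewrite (fill_0 y), (fill_0 (y + W / 2)); [ring| |].
    - apply Hk2; lia.
    - assert (y + W / 2 <= tail (S n)) by (apply Hk2; lia). lra. }
  (* For [y = 0] the window extends to infinity and the pattern never returns to -1.
     [extremal_exists] excludes this alternative. *)
  destruct (Req_dec y 0) as [Hy0|Hy0].
  - left. intros [|n] Hn; [lia|]. simpl.
    rewrite (fill_1 (y + W / 2)), (fill_0 y); [ring| |].
    + rewrite Hy0. apply Rlt_le, tail_pos.
    + apply Rle_trans with (tail k); [apply tail_decr; lia|lra].
  - right. destruct (tail_below y) as [l [Hl [Hl1 Hl2]]]; [lra|].
    (* One heavy weight may contain both ends of the window; the maximum keeps the two exceptional
       indices distinct. *)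
    exists (Nat.max l (S k)). split; [lia|split].
    + intros [|n] Hn; [lia|]. simpl.
      rewrite (fill_1 (y + W / 2)), (fill_0 y); [ring| |].
      * apply Hl2; lia.
      * apply Rle_trans with (tail k); [apply tail_decr; lia|lra].
    + intros [|n] Hn; [lia|]. simpl.
      rewrite (fill_1 (y + W / 2)), (fill_1 y); [ring| |].
      * apply Rle_trans with (tail l); [apply tail_decr; lia|lra].
      * apply Rle_trans with (tail k); [apply tail_decr; lia|lra].
Qed.

End Balance.

Lemma extremal_exists p s t : 0 < p < 1 -> 0 < s < 1 -> 0 < t < 1 ->
  exists e, extremal p s t e.
Proof.
  intros Hp Hs Ht.
  assert (Hpow : forall x, 0 < x < 1 -> forall n, 0 <= x ^ n) by (intros; apply pow_le; lra).
  set (w := raise t (fun m => s ^ m)). set (v := raise t (raise s (fun m => p ^ m))).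
  assert (Hw : ex_series w) by (apply raise_ex_series; auto using ex_series_pow).
  assert (Hr : forall n, 0 <= raise s (fun m => p ^ m) n) by (apply raise_nonneg; [lra|auto]).
  assert (Hv : ex_series v).
  { apply raise_ex_series; [assumption|assumption|].
    apply raise_ex_series; auto using ex_series_pow. }
  assert (Hwpos : forall n, 0 < w (S n)).
  { intros n. simpl. apply Rmult_lt_0_compat; [lra|].
    assert (0 < s ^ n) by (apply pow_lt; lra).
    assert (Hn := raise_nonneg t (fun m => s ^ m) ltac:(lra) (Hpow s Hs) n).
    apply Rplus_le_lt_0_compat; assumption. }
  destruct (balanced_weights w v eq_refl Hwpos Hw (raise_nonneg t _ (proj1 Ht) Hr) Hv)
    as [a [Ha [Aw [Av [k [Hk [Ak Htail]]]]]]].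
  assert (Hab : bounded_seq a) by (exists 1; intros n; apply Rabs_le, Ha).
  (* Adjusting the constant term creates the zero at [t]. The two other moments are unaffected
     because [w] and [v] vanish at index 0. *)
  set (e := fun n => match n with O => a 0%nat - PSeries a t | _ => a n end).
  assert (Heb : bounded_seq e).
  { exists (1 + Rabs (PSeries a t)). assert (Habs := Rabs_pos (PSeries a t)).
    intros [|n]; simpl.
    - eapply Rle_trans; [apply Rabs_triang|]. rewrite Rabs_Ropp.
      apply Rplus_le_compat_r, Rabs_le, Ha.
    - assert (Rabs (a (S n)) <= 1) by apply Rabs_le, Ha. lra. }
  assert (He : vanishes p s t e).
  { apply vanishes_of_moments; try assumption.
    - assert (Hex := bounded_ex_pseries a t Hab ltac:(lra)).
      replace 0 with (PSeries a t + - PSeries a t) by ring.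
      assert (HS : is_series (fun n => a n * t ^ n) (PSeries a t)).
      { apply Series_correct. apply ex_pseries_R. exact Hex. }
      assert (HD : is_series (fun n => match n with O => - PSeries a t | _ => 0 end)
          (- PSeries a t)).
      { refine (is_lim_seq_ext (fun _ => - PSeries a t) (sum_n _)
          (Finite (- PSeries a t)) _ (is_lim_seq_const _)).
        induction n as [|n IH]; [rewrite sum_O; reflexivity|].
        rewrite sum_Sn, <- IH. unfold plus; simpl. ring. }
      eapply is_series_ext; [|apply (is_series_plus _ _ _ _ HS HD)].
      intros [|n]; unfold plus; simpl; ring.
    - eapply is_series_ext; [|exact Aw]. intros [|n]; unfold w; simpl; ring.
    - eapply is_series_ext; [|exact Av]. intros [|n]; unfold v; simpl; ring. }
  exists e. split; [|exact He]. split.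
  { intros [|n] Hn; [lia|]. simpl. apply Ha. }
  destruct Htail as [H1|[l [Hl [H1 H2]]]].
  (* A constant term followed by coefficients -1 and then 1 has at most two sign changes, too few
     for three zeros. *)
  - exfalso.
    assert (H0 := vanishes_two_changes_zero p s t e Hp Hs Ht He).
    specialize (H0 ltac:(apply pat2_intro with 0%nat k; [lia|intros; lia| |];
      intros [|n] Hn; try lia; simpl; [rewrite Ak by lia; lra|rewrite H1 by lia; lra]) (S k)).
    simpl in H0. rewrite H1 in H0 by lia. lra.
  - exists k, l. split; [lia|].
    repeat split; intros [|n] Hn; try lia; simpl; [apply Ak|apply H1|apply H2]; lia.
Qed.

(** * The maximal constant term as a function of the zeros *)

(* The largest constant term of a power series vanishing at p, s, t whose other
   coefficients lie in [-1, 1]. *)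
Definition cmax (p s t : R) : R :=
  epsilon (inhabits 0) (fun c => exists e, extremal p s t e /\ e 0%nat = c).

Lemma cmax_spec p s t : 0 < p < 1 -> 0 < s < 1 -> 0 < t < 1 ->
  exists e, extremal p s t e /\ e 0%nat = cmax p s t.
Proof.
  intros Hp Hs Ht. unfold cmax.
  apply (epsilon_spec (inhabits 0) (fun c => exists e, extremal p s t e /\ e 0%nat = c)).
  destruct (extremal_exists p s t Hp Hs Ht) as [e He].
  exists (e 0%nat), e. split; [exact He|reflexivity].
Qed.

Lemma cmax_ge p s t f : 0 < p < 1 -> 0 < s < 1 -> 0 < t < 1 ->
  vanishes p s t f -> unit_tail f -> f 0%nat <= cmax p s t.
Proof.
  intros Hp Hs Ht Vf Hf. destruct (cmax_spec p s t Hp Hs Ht) as [e [He <-]].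
  destruct (Rle_lt_dec (f 0%nat) (e 0%nat)) as [|Hlt]; [assumption|].
  rewrite (extremal_max p s t e f); try assumption; lra.
Qed.

Lemma cmax_pos p s t : 0 < p < 1 -> 0 < s < 1 -> 0 < t < 1 -> 0 < cmax p s t.
Proof.
  intros Hp Hs Ht. destruct (cmax_spec p s t Hp Hs Ht) as [e [He <-]].
  apply extremal_pos with p s t; assumption.
Qed.

Lemma cmax_swap12 p s t : 0 < p < 1 -> 0 < s < 1 -> 0 < t < 1 -> cmax p s t = cmax s p t.
Proof.
  intros Hp Hs Ht. apply Rle_antisym.
  - destruct (cmax_spec p s t Hp Hs Ht) as [e [[He Ve] <-]].
    apply cmax_ge; try assumption; [apply vanishes_swap12, Ve|exact (proj1 He)].
  - destruct (cmax_spec s p t Hs Hp Ht) as [e [[He Ve] <-]].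
    apply cmax_ge; try assumption; [apply vanishes_swap12, Ve|exact (proj1 He)].
Qed.

Lemma cmax_swap23 p s t : 0 < p < 1 -> 0 < s < 1 -> 0 < t < 1 -> cmax p s t = cmax p t s.
Proof.
  intros Hp Hs Ht. apply Rle_antisym.
  - destruct (cmax_spec p s t Hp Hs Ht) as [e [[He Ve] <-]].
    apply cmax_ge; try assumption; [apply vanishes_swap23, Ve|exact (proj1 He)].
  - destruct (cmax_spec p t s Hp Ht Hs) as [e [[He Ve] <-]].
    apply cmax_ge; try assumption; [apply vanishes_swap23, Ve|exact (proj1 He)].
Qed.

Lemma cmax_lt1 p p' s t : 0 < p -> p < p' -> p' < 1 -> 0 < s < 1 -> 0 < t < 1 ->
  cmax p s t < cmax p' s t.
Proof.
  intros Hp Hpp Hp' Hs Ht.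
  destruct (cmax_spec p s t) as [e [He <-]]; try lra.
  destruct (cmax_spec p' s t) as [e' [He' <-]]; try lra.
  apply extremal_mono with p p' s t; assumption.
Qed.

Lemma cmax_lt2 p s s' t : 0 < p < 1 -> 0 < s -> s < s' -> s' < 1 -> 0 < t < 1 ->
  cmax p s t < cmax p s' t.
Proof.
  intros. rewrite (cmax_swap12 p s t), (cmax_swap12 p s' t) by lra. apply cmax_lt1; lra.
Qed.

Lemma cmax_lt3 p s t t' : 0 < p < 1 -> 0 < s < 1 -> 0 < t -> t < t' -> t' < 1 ->
  cmax p s t < cmax p s t'.
Proof.
  intros. rewrite (cmax_swap23 p s t), (cmax_swap23 p s t') by lra. apply cmax_lt2; lra.
Qed.

Lemma cmax_le p p' s s' t t' : 0 < p -> p <= p' -> p' < 1 ->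
  0 < s -> s <= s' -> s' < 1 -> 0 < t -> t <= t' -> t' < 1 ->
  cmax p s t <= cmax p' s' t'.
Proof.
  intros. apply Rle_trans with (cmax p' s t); [|apply Rle_trans with (cmax p' s' t)].
  - destruct (Req_dec p p') as [->|]; [lra|]. apply Rlt_le, cmax_lt1; lra.
  - destruct (Req_dec s s') as [->|]; [lra|]. apply Rlt_le, cmax_lt2; lra.
  - destruct (Req_dec t t') as [->|]; [lra|]. apply Rlt_le, cmax_lt3; lra.
Qed.

Lemma cmax_lt_diag p s t : 0 < p < 1 -> 0 < s -> s < t -> t < 1 -> cmax p s s < cmax p t t.
Proof.
  intros. apply Rlt_trans with (cmax p t s); [apply cmax_lt2|apply cmax_lt3]; lra.
Qed.

(** * Continuity of the maximal constant term *)

Definition distortion (x y : R) : R := 1 + Rabs (/ x - / y) * (x / (1 - x)).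

Lemma distortion_ge_1 x y : 0 < x < 1 -> 1 <= distortion x y.
Proof.
  intros Hx. unfold distortion. assert (0 <= Rabs (/ x - / y) * (x / (1 - x))); [|lra].
  apply Rmult_le_pos; [apply Rabs_pos|apply Rlt_le, Rdiv_lt_0_compat; lra].
Qed.

Lemma cmax_move p p' s t : 0 < p < 1 -> 0 < p' < 1 -> 0 < s < 1 -> 0 < t < 1 ->
  cmax p s t <= cmax p' s t * distortion p p'.
Proof.
  intros Hp Hp' Hs Ht.
  destruct (cmax_spec p s t) as [e [He <-]]; try lra.
  destruct (cmax_spec p' s t) as [e' [He' <-]]; try lra.
  apply extremal_move with s t; assumption.
Qed.

(** Squeeze theorem: [distortion] tends to 1 on the diagonal but is not symmetric, so the hypothesis
    is applied in both directions. The exponent [k] counts the arguments of [cmax] that move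
    together. *)
Lemma continuous_of_distortion (g : R -> R) (k : nat) :
  (forall x, 0 < x < 1 -> 0 <= g x) ->
  (forall x y, 0 < x < 1 -> 0 < y < 1 -> g x <= g y * distortion x y ^ k) ->
  forall x, 0 < x < 1 -> continuous g x.
Proof.
  intros Hpos Hg x Hx.
  assert (Hinv : continuous (fun y => / y) x) by (apply continuous_Rinv; lra).
  assert (H1 : continuous (fun y => g x * distortion y x ^ k) x).
  { apply (continuous_scal_r (g x) (fun y => distortion y x ^ k)).
    apply (continuous_comp (fun y => distortion y x) (fun z => z ^ k)).
    - unfold distortion. apply (continuous_plus (fun _ => 1)); [apply continuous_const|].
      apply (continuous_mult (fun y => Rabs (/ y - / x)) (fun y => y / (1 - y))).
      + apply continuous_Rabs_comp.
        apply (continuous_minus (fun y => / y) (fun _ => / x)); [exact Hinv|apply continuous_const].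
      + apply (continuous_mult (fun y => y) (fun y => / (1 - y))); [apply continuous_id|].
        apply continuous_Rinv_comp; [|lra].
        apply (continuous_minus (fun _ => 1) (fun y => y)); [apply continuous_const
          |apply continuous_id].
    - apply (ex_derive_continuous (fun z => z ^ k)). auto_derive. exact I. }
  assert (H2 : continuous (fun y => g x / distortion x y ^ k) x).
  { apply (continuous_scal_r (g x) (fun y => / distortion x y ^ k)).
    apply continuous_Rinv_comp.
    - apply (continuous_comp (fun y => distortion x y) (fun z => z ^ k)).
      + unfold distortion. apply (continuous_plus (fun _ => 1)); [apply continuous_const|].
        apply (continuous_mult (fun y => Rabs (/ x - / y)) (fun _ => x / (1 - x)));
          [|apply continuous_const].
        apply continuous_Rabs_comp.
        apply (continuous_minus (fun _ => / x) (fun y => / y)); [apply continuous_const|exact Hinv].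
      + apply (ex_derive_continuous (fun z => z ^ k)). auto_derive. exact I.
    - apply pow_nonzero. assert (H := distortion_ge_1 x x Hx). lra. }
  assert (Hxx : distortion x x = 1).
  { unfold distortion. rewrite Rminus_diag, Rabs_R0. ring. }
  unfold continuous in *. rewrite Hxx, pow1 in H1, H2.
  replace (g x * 1) with (g x) in H1 by ring. replace (g x / 1) with (g x) in H2 by field.
  apply (filterlim_le_le (F := locally x) (fun y => g x / distortion x y ^ k) g
    (fun y => g x * distortion y x ^ k) (g x)); [|exact H2|exact H1].
  apply filter_imp with (fun y => 0 < y /\ y < 1).
  - intros y Hy. assert (Hd : 1 <= distortion x y ^ k) by apply pow_R1_Rle, distortion_ge_1, Hx.
    assert (Ha := Hg x y Hx Hy). assert (Hb := Hg y x Hy Hx).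
    split.
    + apply Rmult_le_reg_r with (distortion x y ^ k); [lra|].
      unfold Rdiv. rewrite Rmult_assoc, Rinv_l, Rmult_1_r by lra. exact Ha.
    + exact Hb.
  - apply filter_and; [apply (open_gt 0)|apply (open_lt 1)]; lra.
Qed.

Lemma cmax_continuous_point s t x : 0 < s < 1 -> 0 < t < 1 -> 0 < x < 1 ->
  continuous (fun y => cmax y s t) x.
Proof.
  intros Hs Ht. apply continuous_of_distortion with 1%nat.
  - intros. apply Rlt_le, cmax_pos; assumption.
  - intros. rewrite pow_1. apply cmax_move; assumption.
Qed.

Lemma cmax_move_pair p x y : 0 < p < 1 -> 0 < x < 1 -> 0 < y < 1 ->
  cmax p x x <= cmax p y y * distortion x y ^ 2.
Proof.
  intros Hp Hx Hy. assert (Hd := distortion_ge_1 x y Hx).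
  apply Rle_trans with (cmax p y x * distortion x y).
  - rewrite (cmax_swap12 p x x), (cmax_swap12 p y x) by assumption. apply cmax_move; assumption.
  - simpl. rewrite Rmult_1_r, <- Rmult_assoc. apply Rmult_le_compat_r; [lra|].
    rewrite (cmax_swap23 p y x), (cmax_swap12 p x y), (cmax_swap12 p y y) by assumption.
    apply cmax_move; assumption.
Qed.

Lemma cmax_continuous_pair p x : 0 < p < 1 -> 0 < x < 1 ->
  continuous (fun y => cmax p y y) x.
Proof.
  intros Hp. apply continuous_of_distortion with 2%nat.
  - intros. apply Rlt_le, cmax_pos; assumption.
  - intros. apply cmax_move_pair; assumption.
Qed.

Lemma cmax_continuous_triple x : 0 < x < 1 -> continuous (fun y => cmax y y y) x.
Proof.
  apply continuous_of_distortion with 3%nat.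
  - intros. apply Rlt_le, cmax_pos; assumption.
  - intros y z Hy Hz. assert (Hd := distortion_ge_1 y z Hy).
    apply Rle_trans with (cmax z y y * distortion y z); [apply cmax_move; assumption|].
    replace (distortion y z ^ 3) with (distortion y z ^ 2 * distortion y z) by ring.
    rewrite <- Rmult_assoc. apply Rmult_le_compat_r; [lra|].
    apply cmax_move_pair; assumption.
Qed.

(** The series shares its constant term with its quotient by the factor at 1/2, and [quotient_bound]
    bounds that by 1. Strictness comes from first moving the other two zeros up. *)
Lemma cmax_half_lt_1 x : 0 < x < 1 -> cmax (1/2) x x < 1.
Proof.
  intros Hx.
  apply Rlt_le_trans with (cmax (1/2) ((x + 1) / 2) ((x + 1) / 2)).
  - apply cmax_lt_diag; lra.
  - destruct (cmax_spec (1/2) ((x + 1) / 2) ((x + 1) / 2)) as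
      [e [[[He _] [q [Hq Eq]]] <-]]; try lra.
    assert (Hb := quotient_bound (1/2) _ ltac:(lra) (bounded_mul _ _ (bounded_mul _ _ Hq))
      ltac:(rewrite <- Eq; exact He) 0%nat).
    replace (1 / 2 / (1 - 1 / 2)) with 1 in Hb by field.
    rewrite Eq. eapply Rle_trans; [apply Rle_abs|exact Hb].
Qed.

(** Dividing by a constant term that is at least 1 keeps the other coefficients in [-1,1]. *)
Lemma in_B_of_cmax p s t : 0 < p < 1 -> 0 < s < 1 -> 0 < t < 1 -> 1 <= cmax p s t ->
  exists c, in_B c /\ vanishes p s t c.
Proof.
  intros Hp Hs Ht H1. destruct (cmax_spec p s t Hp Hs Ht) as [e [[[He _] Ve] E0]].
  rewrite <- E0 in H1.
  exists (fun n => / e 0%nat * e n). split; [split|apply vanishes_scal, Ve].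
  - field. lra.
  - intros n Hn. apply Rabs_le_between. rewrite Rabs_mult.
    rewrite Rabs_pos_eq by (apply Rlt_le, Rinv_0_lt_compat; lra).
    apply Rmult_le_reg_l with (e 0%nat); [lra|].
    rewrite <- Rmult_assoc, Rinv_r, Rmult_1_l by lra.
    apply Rle_trans with 1; [apply Rabs_le, He, Hn|lra].
Qed.

Lemma cmax_ge_1 p s t c : 0 < p < 1 -> 0 < s < 1 -> 0 < t < 1 ->
  in_B c -> vanishes p s t c -> 1 <= cmax p s t.
Proof. intros Hp Hs Ht [H0 Hc] Vc. rewrite <- H0. apply cmax_ge; assumption. Qed.

(** * Multiplicities of zeros *)

(** Leibniz's rule with an affine factor has only two terms; for [n = 0] the spurious [pred 0] is
    cancelled by [INR 0]. *)
Lemma Derive_n_mul p q n x : bounded_seq q -> -1 < x < 1 ->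
  Derive_n (PSeries (mul_factor p q)) n x
  = (1 - x / p) * Derive_n (PSeries q) n x
    - INR n / p * Derive_n (PSeries q) (pred n) x.
Proof.
  intros Hq. revert x. induction n as [|n IH]; intros x Hx.
  - simpl. rewrite PSeries_mul by assumption. unfold Rdiv; ring.
  - assert (Hloc : locally x (fun y => -1 < y < 1)).
    { apply filter_and; [apply (open_gt (-1))|apply (open_lt 1)]; lra. }
    assert (Hd : forall m, is_derive (Derive_n (PSeries q) m) x (Derive_n (PSeries q) (S m) x)).
    { intros m. apply Derive_correct.
      apply (ex_derive_n_PSeries (S m)). apply bounded_CV_radius; assumption. }
    assert (Hpred : is_derive (fun y => INR n / p * Derive_n (PSeries q) (pred n) y) x
      (INR n / p * Derive_n (PSeries q) n x)).
    { destruct n as [|n].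
      - simpl INR. apply (is_derive_ext (fun _ => 0)); [intros y|].
        { change (@eq R 0 (0 / p * Derive_n (PSeries q) (pred 0) y)). unfold Rdiv; ring. }
        replace (0 / p * _) with 0 by (unfold Rdiv; ring).
        apply is_derive_Reals, derivable_pt_lim_const.
      - apply (is_derive_scal (Derive_n (PSeries q) n)). apply Hd. }
    change (Derive (Derive_n (PSeries (mul_factor p q)) n) x
      = (1 - x / p) * Derive_n (PSeries q) (S n) x - INR (S n) / p * Derive_n (PSeries q) n x).
    rewrite (Derive_ext_loc _ (fun y => (1 - y / p) * Derive_n (PSeries q) n y
      - INR n / p * Derive_n (PSeries q) (pred n) y)).
    2: { apply filter_imp with (2 := Hloc). exact IH. }
    apply is_derive_unique.
    replace ((1 - x / p) * Derive_n (PSeries q) (S n) x - INR (S n) / p * Derive_n (PSeries q) n x)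
      with (minus ((- / p) * Derive_n (PSeries q) n x
                   + (1 - x / p) * Derive_n (PSeries q) (S n) x)
        (INR n / p * Derive_n (PSeries q) n x)).
    2: { rewrite S_INR. unfold minus, plus, opp; simpl. unfold Rdiv. ring. }
    apply (is_derive_minus (fun y => (1 - y / p) * Derive_n (PSeries q) n y)); [|exact Hpred].
    apply (is_derive_mult (fun y => 1 - y / p) (Derive_n (PSeries q) n) x (- / p)).
    + auto_derive; [exact I|]. unfold Rdiv. ring.
    + apply Hd.
    + intros a b. apply Rmult_comm.
Qed.

Lemma Derive_n_mul_at p q n : 0 < p < 1 -> bounded_seq q ->
  Derive_n (PSeries (mul_factor p q)) (S n) p = - (INR (S n) / p) * Derive_n (PSeries q) n p.
Proof.
  intros Hp Hq. rewrite Derive_n_mul by (assumption || lra).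
  replace (1 - p / p) with 0 by (field; lra). simpl pred. ring.
Qed.

Lemma one_minus_div_neq_0 p x : 0 < p -> x <> p -> 1 - x / p <> 0.
Proof.
  intros Hp Hne H0. apply Hne. apply Rmult_eq_reg_r with (/ p).
  - rewrite Rinv_r by lra. unfold Rdiv in H0. lra.
  - apply Rinv_neq_0_compat. lra.
Qed.

Lemma INR_div_neq_0 p n : 0 < p -> - (INR (S n) / p) <> 0.
Proof.
  intros Hp. assert (0 < INR (S n) / p); [|lra].
  apply Rdiv_lt_0_compat; [apply lt_0_INR; lia|exact Hp].
Qed.

Lemma zero_mult_ge_mul_at p q m : 0 < p < 1 -> bounded_seq q ->
  (zero_mult_ge (PSeries (mul_factor p q)) p (S m) <-> zero_mult_ge (PSeries q) p m).
Proof.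
  intros Hp Hq. split.
  - intros H j Hj. assert (H' := H (S j) ltac:(lia)).
    rewrite Derive_n_mul_at in H' by assumption.
    apply Rmult_integral in H'. destruct H' as [H'|H']; [|exact H'].
    exfalso. exact (INR_div_neq_0 p j (proj1 Hp) H').
  - intros H [|j] Hj.
    + simpl. rewrite PSeries_mul by (assumption || lra).
      replace (1 - p / p) with 0 by (field; lra). ring.
    + rewrite Derive_n_mul_at, H by (assumption || lia). ring.
Qed.

Lemma zero_mult_ge_mul_off p q x m : 0 < p < 1 -> -1 < x < 1 -> x <> p -> bounded_seq q ->
  (zero_mult_ge (PSeries (mul_factor p q)) x m <-> zero_mult_ge (PSeries q) x m).
Proof.
  intros Hp Hx Hne Hq. assert (Hnz := one_minus_div_neq_0 p x (proj1 Hp) Hne). split.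
  - intros H j Hj. induction j as [|j IH].
    + assert (H' := H 0%nat Hj). rewrite Derive_n_mul in H' by assumption.
      simpl INR in H'. unfold Rdiv in H' at 2. rewrite !Rmult_0_l, Rminus_0_r in H'.
      apply Rmult_integral in H'. tauto.
    + assert (H' := H (S j) Hj). rewrite Derive_n_mul in H' by assumption.
      simpl pred in H'. rewrite IH, Rmult_0_r, Rminus_0_r in H' by lia.
      apply Rmult_integral in H'. tauto.
  - intros H j Hj. rewrite Derive_n_mul, !H by (assumption || lia). ring.
Qed.

(** Counting occurrences in the list of zeros turns coincidence into multiplicity, so equal and
    distinct zeros are treated alike. *)
Lemma zero_mult_mul p q x l : 0 < p < 1 -> -1 < x < 1 -> bounded_seq q ->
  zero_mult (PSeries q) x (count_occ Req_EM_T l x) ->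
  zero_mult (PSeries (mul_factor p q)) x (count_occ Req_EM_T (p :: l) x).
Proof.
  intros Hp Hx Hq [H1 H2]. simpl. destruct (Req_EM_T p x) as [<-|Hne].
  - split; [apply zero_mult_ge_mul_at; assumption|].
    rewrite Derive_n_mul_at by assumption.
    apply Rmult_integral_contrapositive_currified; [apply INR_div_neq_0; lra|exact H2].
  - split; [apply zero_mult_ge_mul_off; auto|].
    set (m := count_occ Req_EM_T l x) in *.
    rewrite Derive_n_mul by assumption.
    assert (Hz : INR m / p * Derive_n (PSeries q) (pred m) x = 0).
    { destruct m as [|m]; [simpl; unfold Rdiv; ring|].
      simpl pred. rewrite H1 by lia. ring. }
    rewrite Hz, Rminus_0_r. apply Rmult_integral_contrapositive_currified; [|exact H2].
    apply one_minus_div_neq_0; [lra|auto].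
Qed.

Lemma divide_zero a p l : 0 < p < 1 -> bounded_seq a ->
  (forall x, 0 < x < 1 -> zero_mult_ge (PSeries a) x (count_occ Req_EM_T (p :: l) x)) ->
  exists K, bounded_seq K /\ a = mul_factor p K /\
    forall x, 0 < x < 1 -> zero_mult_ge (PSeries K) x (count_occ Req_EM_T l x).
Proof.
  intros Hp Ha H.
  assert (H0 : PSeries a p = 0).
  { apply (H p Hp 0%nat). simpl. destruct (Req_EM_T p p); [lia|congruence]. }
  destruct (mul_of_zero a p Hp Ha H0) as [K [HK ->]].
  exists K. split; [exact HK|split; [reflexivity|]].
  intros x Hx. specialize (H x Hx). simpl in H.
  destruct (Req_EM_T p x) as [<-|Hne].
  - exact (proj1 (zero_mult_ge_mul_at p K _ Hp HK) H).
  - exact (proj1 (zero_mult_ge_mul_off p K x _ Hp ltac:(lra) (not_eq_sym Hne) HK) H).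
Qed.

Lemma vanishes_of_mult p s t a : 0 < p < 1 -> 0 < s < 1 -> 0 < t < 1 -> bounded_seq a ->
  (forall x, 0 < x < 1 -> zero_mult_ge (PSeries a) x (count_occ Req_EM_T [p; s; t] x)) ->
  vanishes p s t a.
Proof.
  intros Hp Hs Ht Ha H.
  destruct (divide_zero a p _ Hp Ha H) as [b [Hb [-> Hb']]].
  destruct (divide_zero b s _ Hs Hb Hb') as [d [Hd [-> Hd']]].
  destruct (divide_zero d t _ Ht Hd Hd') as [q [Hq [-> _]]].
  exists q. split; [exact Hq|reflexivity].
Qed.

Lemma vanishes_triple_mult x a : 0 < x < 1 -> vanishes x x x a ->
  zero_mult_ge (PSeries a) x 3.
Proof.
  intros Hx [q [Hq ->]].
  apply zero_mult_ge_mul_at; [assumption|do 2 apply bounded_mul; assumption|].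
  apply zero_mult_ge_mul_at; [assumption|apply bounded_mul; assumption|].
  apply zero_mult_ge_mul_at; [assumption|assumption|].
  intros j Hj. lia.
Qed.

Lemma triple_mult_vanishes x a : 0 < x < 1 -> bounded_seq a ->
  zero_mult_ge (PSeries a) x 3 -> vanishes x x x a.
Proof.
  intros Hx Ha H. apply vanishes_of_mult; try assumption.
  intros y Hy. simpl. destruct (Req_EM_T x y) as [<-|]; [exact H|intros j Hj; lia].
Qed.

Lemma extremal_mult p s t e x : 0 < p < 1 -> 0 < s < 1 -> 0 < t < 1 -> 0 < x < 1 ->
  extremal p s t e -> zero_mult (PSeries e) x (count_occ Req_EM_T [p; s; t] x).
Proof.
  intros Hp Hs Ht Hx He.
  destruct (extremal_quotient p s t e Hp Hs Ht He) as [q [Hq [-> [Hq0 Hqp]]]].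
  apply zero_mult_mul; [assumption|lra|do 2 apply bounded_mul; assumption|].
  apply zero_mult_mul; [assumption|lra|apply bounded_mul; assumption|].
  apply zero_mult_mul; [assumption|lra|assumption|].
  split; [intros j Hj; simpl in Hj; lia|]. simpl.
  assert (H := PSeries_nonneg q x Hq ltac:(lra) Hqp). lra.
Qed.

Lemma extremal_xi3 p t e : 0 < p -> p < t -> t < 1 -> extremal p t t e ->
  is_xi 3 (PSeries e) t.
Proof.
  intros Hp Hpt Ht He.
  exists (fun k => match k with O | 1%nat => p | 2%nat | 3%nat => t | _ => 1 end).
  split; [|reflexivity]. split; [|split].
  - intros [|[|[|[|k]]]] Hk; lra.
  - intros [|[|[|[|i]]]] [|[|[|[|j]]]] Hij; try lia; lra.
  - intros x Hx.
    assert (Hm := extremal_mult p t t e x ltac:(lra) ltac:(lra) ltac:(lra) Hx He).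
    simpl in Hm.
    destruct (Req_EM_T p x) as [Hpx|Hpx]; destruct (Req_EM_T t x) as [Htx|Htx]; [lra|..].
    + subst x. exists [1%nat]. split; [repeat constructor; simpl; tauto|split; [|exact Hm]].
      intros [|[|[|[|k]]]]; simpl; (split;
        [intros H0; repeat destruct H0 as [H0|H0]; try lia; try contradiction;
          (split; [lia|reflexivity])
        |intros [H0 H1]; try lia; try lra; tauto]).
    + subst x. exists [2%nat; 3%nat].
      split; [repeat constructor; simpl; lia|split; [|exact Hm]].
      intros [|[|[|[|k]]]]; simpl; (split;
        [intros H0; repeat destruct H0 as [H0|H0]; try lia; try contradiction;
          (split; [lia|reflexivity])
        |intros [H0 H1]; try lia; try lra; tauto]).
    + exists []. split; [constructor|split; [|exact Hm]].
      intros [|[|[|[|k]]]]; simpl; (split;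
        [intros H0; repeat destruct H0 as [H0|H0]; try lia; try contradiction;
          (split; [lia|reflexivity])
        |intros [H0 H1]; try lia; try lra; tauto]).
Qed.

Lemma in_B_bounded c : in_B c -> bounded_seq c.
Proof.
  intros [H0 Hc]. exists 1. intros [|n]; [rewrite H0, Rabs_R1; lra|].
  apply Rabs_le, Hc. lia.
Qed.

(** This passes from the ordered enumeration to divisibility. The last clause serves to recognise a
    prescribed zero below [x] as [r] or [s]. *)
Lemma xi3_vanishes c x : in_B c -> is_xi 3 (PSeries c) x -> x < 1 ->
  exists r s, 0 < r /\ r <= s /\ s <= x /\ vanishes r s x c /\
    forall y, 0 < y < x -> PSeries c y = 0 -> y = r \/ y = s.
Proof.
  intros Hc [xi [[Hr [Hi Hm]] Hx]] Hx1. subst x.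
  assert (H12 : xi 1%nat <= xi 2%nat) by (apply Hi; lia).
  assert (H23 : xi 2%nat <= xi 3%nat) by (apply Hi; lia).
  assert (H1 : 0 < xi 1%nat <= 1) by (apply Hr; lia).
  exists (xi 1%nat), (xi 2%nat). split; [lra|split; [lra|split; [lra|split]]].
  - apply vanishes_of_mult; try lra; [apply in_B_bounded, Hc|].
    intros y Hy. destruct (Hm y Hy) as [l [Hnd [Hl [Hz _]]]].
    intros j Hj. apply Hz. eapply Nat.lt_le_trans; [exact Hj|].
    (* These are the indices among 1, 2, 3 whose entry is [y]. They lie in [l] without repetition,
       so their number is at most the multiplicity of [y]. *)
    set (l3 := filter (fun k => if Req_EM_T (xi k) y then true else false) [1%nat; 2%nat; 3%nat]).
    replace (count_occ Req_EM_T [xi 1%nat; xi 2%nat; xi 3%nat] y) with (length l3).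
    + apply NoDup_incl_length.
      * apply NoDup_filter. repeat constructor; simpl; lia.
      * intros k Hk. apply filter_In in Hk. destruct Hk as [Hk1 Hk2].
        apply Hl. split; [simpl in Hk1; lia|].
        destruct (Req_EM_T (xi k) y); [assumption|discriminate].
    + unfold l3. simpl.
      destruct (Req_EM_T (xi 1%nat) y); destruct (Req_EM_T (xi 2%nat) y);
        destruct (Req_EM_T (xi 3%nat) y); reflexivity.
  - intros y Hy H0. destruct (Hm y) as [l [_ [Hl [_ Hnz]]]]; [lra|].
    destruct l as [|k l]; [simpl in Hnz; contradiction|].
    destruct (proj1 (Hl k) (or_introl eq_refl)) as [Hk1 Hk2].
    destruct (Nat.le_gt_cases 3 k) as [Hk|Hk].
    + assert (xi 3%nat <= xi k) by (apply Hi; lia). lra.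
    + assert (k = 1%nat \/ k = 2%nat) as [->| ->] by lia; auto.
Qed.

(** * Closed forms *)

Definition step (k n : nat) : R := if (n <? k)%nat then 0 else 1.

Lemma step_lt k n : (n < k)%nat -> step k n = 0.
Proof. intros Hn. unfold step. apply Nat.ltb_lt in Hn. rewrite Hn. reflexivity. Qed.

Lemma step_ge k n : (k <= n)%nat -> step k n = 1.
Proof. intros Hn. unfold step. apply Nat.ltb_ge in Hn. rewrite Hn. reflexivity. Qed.

Lemma bounded_step k : bounded_seq (step k).
Proof.
  exists 1. intros n. unfold step. destruct (n <? k)%nat; apply Rabs_le; lra.
Qed.

Lemma PSeries_step k x : -1 < x < 1 -> PSeries (step k) x = x ^ k / (1 - x).
Proof.
  intros Hx. induction k as [|k IH].
  - rewrite (PSeries_ext _ (fun _ => 1)) by (intros n; reflexivity).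
    unfold PSeries. rewrite (Series_ext _ (fun n => x ^ n)) by (intros n; ring).
    rewrite Series_geom by (apply Rabs_def1; lra). simpl. field. lra.
  - rewrite (PSeries_ext _ (PS_incr_1 (step k))) by (intros [|n]; reflexivity).
    rewrite PSeries_incr_1, IH. simpl. field. lra.
Qed.

Definition lin (c d : R) (a b : nat -> R) (n : nat) : R := c * a n + d * b n.

Lemma bounded_lin c d a b : bounded_seq a -> bounded_seq b -> bounded_seq (lin c d a b).
Proof.
  intros Ha Hb. replace (lin c d a b) with (fun n => c * a n - (- d) * b n).
  - apply bounded_minus; apply bounded_scal; assumption.
  - apply functional_extensionality; intros n. unfold lin. ring.
Qed.

Lemma PSeries_lin c d a b x : bounded_seq a -> bounded_seq b -> -1 < x < 1 ->
  PSeries (lin c d a b) x = c * PSeries a x + d * PSeries b x.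
Proof.
  intros Ha Hb Hx. rewrite <- !PSeries_scal, <- PSeries_plus.
  - apply PSeries_ext. intros n. reflexivity.
  - apply bounded_ex_pseries; [apply bounded_scal|]; assumption.
  - apply bounded_ex_pseries; [apply bounded_scal|]; assumption.
Qed.

Lemma sum_pow k l x : x <> 1 -> (1 <= k)%nat -> (k - 1 <= l)%nat ->
  sum_n_m (fun i => x ^ i) k l = (x ^ k - x ^ S l) / (1 - x).
Proof.
  intros Hx Hk Hl. induction l as [|l IH].
  - replace k with 1%nat by lia. rewrite sum_n_m_zero by lia.
    unfold zero; simpl. field. lra.
  - destruct (Nat.eq_dec k (S (S l))) as [->|Hne].
    + rewrite sum_n_m_zero by lia. unfold zero; simpl. field. lra.
    + rewrite sum_n_Sm, IH by lia. unfold plus; simpl. field. lra.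
Qed.

(** Writing the sequence as the combination of its jumps reduces the series to geometric tails. *)
Lemma bang_bang_H e k l : (1 <= k < l)%nat -> e 0%nat = 1 ->
  (forall n, (1 <= n < k)%nat -> e n = -1) ->
  (forall n, (k < n < l)%nat -> e n = 1) ->
  (forall n, (l < n)%nat -> e n = -1) ->
  forall x, -1 < x < 1 -> PSeries e x = H k l (e k) (e l) x.
Proof.
  intros Hkl E0 E1 E2 E3 x Hx.
  assert (He : e = lin 1 1 (lin 1 (-2) (step 0) (step 1))
    (lin 1 1 (lin (e k + 1) (1 - e k) (step k) (step (S k)))
             (lin (e l - 1) (-1 - e l) (step l) (step (S l))))).
  { apply functional_extensionality. intros n. unfold lin.
    rewrite (step_ge 0) by lia.
    destruct (Nat.eq_dec n 0) as [->|]; [rewrite !step_lt, E0 by lia; ring|].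
    rewrite (step_ge 1) by lia.
    destruct (Nat.lt_trichotomy n k) as [|[->|]].
    { rewrite !step_lt, E1 by lia; ring. }
    { rewrite (step_ge k), !step_lt by lia; ring. }
    rewrite (step_ge k), (step_ge (S k)) by lia.
    destruct (Nat.lt_trichotomy n l) as [|[->|]].
    { rewrite !step_lt, E2 by lia; ring. }
    { rewrite (step_ge l), !step_lt by lia; ring. }
    rewrite !step_ge, E3 by lia; ring. }
  rewrite He at 1.
  assert (B := bounded_step).
  rewrite !PSeries_lin, !PSeries_step by (repeat apply bounded_lin; auto).
  unfold H. rewrite !sum_pow by (lra || lia).
  replace (S (k - 1)) with k by lia. replace (S (l - 1)) with l by lia.
  replace (k + 1)%nat with (S k) by lia. replace (l + 1)%nat with (S l) by lia.
  simpl. field. lra.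
Qed.

(** * A series in the class with three zeros, for every gamma above 1/2 *)

Lemma bernoulli x n : 0 <= x <= 1 -> 1 - INR n * (1 - x) <= x ^ n.
Proof.
  intros Hx. induction n as [|n IH]; [simpl; lra|].
  rewrite S_INR. simpl.
  assert (0 <= 1 - x ^ n).
  { assert (x ^ n <= 1 ^ n) by (apply pow_incr; lra). rewrite pow1 in *. lra. }
  assert (0 <= (1 - x ^ n) * (1 - x)) by (apply Rmult_le_pos; lra). lra.
Qed.

Lemma pow_small x y : 0 < x < 1 -> 0 < y -> exists N, forall n, (N <= n)%nat -> x ^ n < y.
Proof.
  intros Hx Hy. destruct (pow_lt_1_zero x) with (y := y) as [N HN];
    [rewrite Rabs_pos_eq; lra|exact Hy|].
  exists N. intros n Hn. eapply Rle_lt_trans; [apply Rle_abs|apply HN; lia].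
Qed.

Lemma PSeries_IVT a x y : bounded_seq a -> -1 < x -> x < y -> y < 1 ->
  PSeries a x * PSeries a y < 0 -> exists z, x < z < y /\ PSeries a z = 0.
Proof.
  intros Ha Hx Hxy Hy H0.
  assert (Hc : forall z, x <= z <= y -> continuity_pt (PSeries a) z).
  { intros z Hz. apply PSeries_continuity, bounded_CV_radius; [assumption|lra]. }
  assert (Hz : exists z, x <= z <= y /\ PSeries a z = 0).
  { destruct (Rlt_le_dec (PSeries a x) 0) as [Hn|Hn].
    - assert (0 < PSeries a y).
      { apply Rnot_le_lt. intros Hle.
        assert (0 <= - PSeries a x * - PSeries a y) by (apply Rmult_le_pos; lra). lra. }
      destruct (IVT_interv (PSeries a) x y Hc Hxy Hn) as [z Hz]; [assumption|].
      exists z. exact Hz.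
    - assert (Hy0 : PSeries a y < 0).
      { apply Rnot_le_lt. intros Hle.
        assert (0 <= PSeries a x * PSeries a y) by (apply Rmult_le_pos; lra). lra. }
      assert (Hx0 : 0 < PSeries a x).
      { destruct (Req_dec (PSeries a x) 0) as [E|]; [rewrite E in H0|]; lra. }
      destruct (IVT_interv (fun z => - PSeries a z) x y) as [z [Hz Hz0]]; try lra.
      + intros z Hz. apply continuity_pt_opp, Hc, Hz.
      + exists z. split; [exact Hz|lra]. }
  destruct Hz as [z [Hz Hz0]]. exists z. split; [|exact Hz0].
  split; apply Rnot_le_lt; intros Hle.
  - replace z with x in Hz0 by lra. rewrite Hz0 in H0. lra.
  - replace z with y in Hz0 by lra. rewrite Hz0 in H0. lra.
Qed.

Section Example.
Variables (b : R) (M L : nat).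
Hypothesis Hb : 0 <= b <= 1.
Hypothesis HM : (1 <= M)%nat.

(* The series of 1 - b x / (1 - x) + x^M (1 - x^L) / (1 - x). *)
Definition example : nat -> R :=
  lin 1 1 (lin 1 (- (1 + b)) (step 0) (step 1)) (lin 1 (-1) (step M) (step (M + L))).

Lemma bounded_example : bounded_seq example.
Proof. repeat apply bounded_lin; apply bounded_step. Qed.

Lemma example_0 : 0 < PSeries example 0.
Proof.
  rewrite PSeries_0. unfold example, lin. rewrite (step_ge 0), !step_lt by lia. lra.
Qed.

Lemma PSeries_example x : -1 < x < 1 ->
  PSeries example x * (1 - x) = 1 - (1 + b) * x + x ^ M - x ^ (M + L).
Proof.
  intros Hx. assert (B := bounded_step). unfold example.
  rewrite !PSeries_lin, !PSeries_step by (repeat apply bounded_lin; auto).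
  simpl. field. lra.
Qed.

Lemma example_in_B : in_B example.
Proof.
  split.
  - unfold example, lin. rewrite (step_ge 0), !step_lt by lia. ring.
  - intros n Hn. unfold example, lin. rewrite (step_ge 0), (step_ge 1) by lia.
    unfold step. destruct (n <? M)%nat eqn:E1; destruct (n <? M + L)%nat eqn:E2; try lra.
    apply Nat.ltb_lt in E1. apply Nat.ltb_ge in E2. lia.
Qed.

End Example.

(** The example is positive at 0, vanishes at [g], is positive at some [x1] beyond [g] and negative
    near 1. Hence it has a zero [t] beyond [x1] and, once [g] and [t] are divided out, a third zero
    [s] below [x1]. Monotonicity of [cmax] replaces [s] by [t]. *)
Lemma three_zeros_above_half g : 1/2 < g < 1 ->
  exists x, 0 < x < 1 /\ 1 <= cmax g x x.
Proof.
  intros Hg.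
  destruct (pow_small g (2 * g - 1)) as [M0 HM0]; [lra|lra|].
  set (M := S M0). assert (HgM : g ^ M < 2 * g - 1) by (apply HM0; unfold M; lia).
  assert (HgM0 : 0 < g ^ M) by (apply pow_lt; lra).
  (* This is the value of [b] that would give a zero at [g] for infinite [L]. It bounds the actual
     [b], and the choice of [M] makes it less than 1. *)
  set (beta := (1 - g + g ^ M) / g).
  assert (Hbeta : 0 < beta < 1).
  { unfold beta. split; [apply Rdiv_lt_0_compat; lra|].
    apply Rmult_lt_reg_r with g; [lra|]. unfold Rdiv. rewrite Rmult_assoc, Rinv_l by lra. lra. }
  assert (HMR : 1 <= INR M) by (unfold M; rewrite S_INR; assert (Hp := pos_INR M0); lra).
  (* As [L] grows, positivity at [x1] follows from [beta < x1 ^ M], which holds close to 1. *)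
  assert (Hx1 : exists x1, g < x1 < 1 /\ beta < x1 ^ M).
  { set (h := Rmin ((1 - g) / 2) ((1 - beta) / (2 * INR M))).
    assert (Hh : 0 < h).
    { unfold h. apply Rmin_glb_lt; apply Rdiv_lt_0_compat; lra. }
    assert (Hh1 : h <= (1 - g) / 2) by apply Rmin_l.
    assert (Hh2 : INR M * h < 1 - beta).
    { apply Rle_lt_trans with (INR M * ((1 - beta) / (2 * INR M))).
      - apply Rmult_le_compat_l; [lra|apply Rmin_r].
      - replace (INR M * ((1 - beta) / (2 * INR M))) with ((1 - beta) / 2) by (field; lra). lra. }
    exists (1 - h). split; [lra|].
    assert (Hber := bernoulli (1 - h) M ltac:(lra)).
    replace (1 - (1 - h)) with h in Hber by ring. lra. }
  destruct Hx1 as [x1 [Hx1 Hx1M]].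
  destruct (pow_small x1 (x1 ^ M - beta)) as [L HL]; [lra|lra|].
  specialize (HL (M + L)%nat ltac:(lia)).
  set (b := (1 - g + g ^ M - g ^ (M + L)) / g).
  assert (HgML : 0 < g ^ (M + L) <= g ^ M).
  { split; [apply pow_lt; lra|]. rewrite pow_add.
    assert (g ^ L <= 1 ^ L) by (apply pow_incr; lra). rewrite pow1 in *.
    rewrite <- (Rmult_1_r (g ^ M)) at 2. apply Rmult_le_compat_l; lra. }
  assert (Hb : 0 < b <= beta).
  { unfold b, beta. split; [apply Rdiv_lt_0_compat; lra|].
    apply Rmult_le_compat_r; [apply Rlt_le, Rinv_0_lt_compat; lra|lra]. }
  assert (HM1 : (1 <= M)%nat) by (unfold M; lia).
  set (f := example b M L).
  assert (Hf : bounded_seq f) by apply bounded_example.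
  assert (Hfg : PSeries f g = 0).
  { apply Rmult_eq_reg_r with (1 - g); [|lra].
    unfold f. rewrite PSeries_example by lra. unfold b. field. lra. }
  assert (Hf1 : 0 < PSeries f x1).
  { apply Rmult_lt_reg_r with (1 - x1); [lra|].
    unfold f. rewrite PSeries_example by lra.
    assert (b * x1 <= beta * 1) by (apply Rmult_le_compat; lra). lra. }
  (* Near 1 the product of [f] and [1 - x] tends to [- b], which is negative; Bernoulli's inequality
     makes this quantitative. *)
  assert (Hx2 : exists x2, x1 < x2 < 1 /\ PSeries f x2 < 0).
  { assert (HLR := pos_INR L).
    set (h := Rmin ((1 - x1) / 2) (b / (2 * (1 + INR L + b)))).
    assert (Hh : 0 < h).
    { unfold h. apply Rmin_glb_lt; apply Rdiv_lt_0_compat; lra. }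
    assert (Hh1 : h <= (1 - x1) / 2) by apply Rmin_l.
    assert (Hh2 : (1 + INR L + b) * h < b).
    { apply Rle_lt_trans with ((1 + INR L + b) * (b / (2 * (1 + INR L + b)))).
      - apply Rmult_le_compat_l; [lra|apply Rmin_r].
      - replace ((1 + INR L + b) * (b / (2 * (1 + INR L + b)))) with (b / 2) by (field; lra). lra. }
    exists (1 - h). split; [lra|].
    apply Rmult_lt_reg_r with (1 - (1 - h)); [lra|].
    unfold f. rewrite PSeries_example by lra.
    assert (Hber := bernoulli (1 - h) L ltac:(lra)).
    replace (1 - (1 - h)) with h in * by ring.
    rewrite pow_add.
    assert (HP : 0 <= (1 - h) ^ M <= 1).
    { assert (HP := pow_incr (1 - h) 1 M ltac:(lra)). rewrite pow1 in HP.
      split; [apply pow_le|]; lra. }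
    assert ((1 - h) ^ M * (1 - (1 - h) ^ L) <= 1 * (INR L * h)).
    { apply Rmult_le_compat; try lra.
      assert ((1 - h) ^ L <= 1 ^ L) by (apply pow_incr; lra). rewrite pow1 in *. lra. }
    lra. }
  destruct Hx2 as [x2 [Hx2 Hf2]].
  destruct (PSeries_IVT f x1 x2 Hf) as [t [Ht Hft]]; try lra.
  { assert (0 < PSeries f x1 * - PSeries f x2) by (apply Rmult_lt_0_compat; lra). lra. }
  destruct (mul_of_zero f g ltac:(lra) Hf Hfg) as [K [HK EK]].
  assert (Hgx : forall x, g < x -> 1 - x / g < 0).
  { intros x Hx. cut (1 < x / g); [lra|]. apply Rmult_lt_reg_r with g; [lra|].
    unfold Rdiv. rewrite Rmult_assoc, Rinv_l by lra. lra. }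
  assert (HKt : PSeries K t = 0).
  { rewrite EK, PSeries_mul in Hft by (assumption || lra).
    apply Rmult_integral in Hft. specialize (Hgx t ltac:(lra)). lra. }
  destruct (mul_of_zero K t ltac:(lra) HK HKt) as [J [HJ EJ]].
  assert (HJ0 : 0 < PSeries J 0).
  { assert (H0 := example_0 b M L HM1). fold f in H0.
    rewrite EK, EJ, !PSeries_0 in H0. rewrite PSeries_0. exact H0. }
  assert (HJ1 : PSeries J x1 < 0).
  { rewrite EK, EJ, !PSeries_mul in Hf1 by (try apply bounded_mul; assumption || lra).
    specialize (Hgx x1 ltac:(lra)).
    assert (Htx : 0 < 1 - x1 / t).
    { cut (x1 / t < 1); [lra|]. apply Rmult_lt_reg_r with t; [lra|].
      unfold Rdiv. rewrite Rmult_assoc, Rinv_l by lra. lra. }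
    apply Rnot_le_lt. intros Hle.
    assert (0 <= - (1 - x1 / g) * ((1 - x1 / t) * PSeries J x1)).
    { apply Rmult_le_pos; [lra|apply Rmult_le_pos; lra]. }
    lra. }
  (* At [x1] the factor for [g] is negative and the one for [t] positive, so [J] changes sign. Its
     zero [s] may equal [g], which covers a double zero there. *)
  destruct (PSeries_IVT J 0 x1 HJ) as [s [Hs HJs]]; try lra.
  { assert (0 < PSeries J 0 * - PSeries J x1) by (apply Rmult_lt_0_compat; lra). lra. }
  destruct (mul_of_zero J s ltac:(lra) HJ HJs) as [q [Hq Eq]].
  exists t. split; [lra|].
  apply Rle_trans with (cmax g t s); [|apply cmax_le; lra].
  apply cmax_ge_1 with f; try lra.
  - apply example_in_B; [lra|exact HM1].
  - exists q. split; [exact Hq|]. rewrite EK, EJ, Eq. reflexivity.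
Qed.

(** * The function psi *)

Lemma pat_no_chain a r : forall sg i n, sg <> 0 -> (i <= n 0%nat)%nat -> sign_pattern r sg i a ->
  ~ (forall j, (j < S r)%nat -> (n j < n (S j))%nat /\ a (n j) * a (n (S j)) < 0).
Proof.
  assert (Hsame : forall sg x y, sg <> 0 -> 0 <= sg * x -> 0 <= sg * y -> 0 <= x * y).
  { intros sg x y Hsg Hx Hy. assert (H1 := Rmult_le_pos _ _ Hx Hy).
    apply Rmult_le_reg_l with (sg * sg); [|lra].
    assert (H2 := Rsqr_pos_lt sg Hsg). exact H2. }
  induction r as [|r IH]; intros sg i n Hsg Hi Hpat Hch;
    destruct (Hch 0%nat ltac:(lia)) as [Hlt Hneg].
  - simpl in Hpat. assert (H1 := Hsame sg _ _ Hsg (Hpat (n 0%nat) Hi) (Hpat (n 1%nat) ltac:(lia))).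
    lra.
  - destruct Hpat as [k [Hk [Hpos Hrest]]].
    destruct (Nat.lt_ge_cases (n 1%nat) k) as [Hn|Hn].
    + assert (H1 := Hsame sg _ _ Hsg (Hpos (n 0%nat) ltac:(lia)) (Hpos (n 1%nat) ltac:(lia))). lra.
    + apply (IH (- sg) k (fun j => n (S j))); [lra|exact Hn|exact Hrest|].
      intros j Hj. apply Hch. lia.
Qed.

(** The bang-bang form alone allows empty runs and hence fewer changes. Here the zeros force them:
    if no positive coefficient followed a negative one, [-e] would have at most two changes. *)
Lemma extremal_sign_changes p s t e : 0 < p < 1 -> 0 < s < 1 -> 0 < t < 1 ->
  extremal p s t e -> sign_changes e 3.
Proof.
  intros Hp Hs Ht He. assert (H0 := extremal_pos p s t e Hp Hs Ht He).
  split.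
  - assert (Hb := He). destruct Hb as [[_ [k [l [Hkl [_ [_ E3]]]]]] Ve].
    assert (Hex : exists n1 n2, (n1 < n2)%nat /\ e n1 < 0 /\ 0 < e n2).
    { apply NNPP. intros Hno.
      assert (Hfirst : exists m, e m < 0 /\ forall n, (n < m)%nat -> 0 <= e n).
      { assert (Hm : e (S l) < 0) by (rewrite E3 by lia; lra).
        revert Hm. generalize (S l). intros m.
        induction m as [m IH] using (well_founded_induction Wf_nat.lt_wf). intros Hm.
        destruct (classic (exists m', (m' < m)%nat /\ e m' < 0)) as [[m' [H1 H2]]|Hn].
        - apply (IH m'); assumption.
        - exists m. split; [exact Hm|]. intros n Hn'.
          destruct (Rle_lt_dec 0 (e n)); [assumption|]. exfalso. apply Hn. exists n. tauto. }
      destruct Hfirst as [m [Hm Hbefore]].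
      assert (Hz := vanishes_two_changes_zero p s t _ Hp Hs Ht (vanishes_scal _ _ _ (-1) _ Ve)).
      specialize (Hz ltac:(apply pat2_intro with 0%nat m;
        [destruct m; [lra|lia]|intros; lia
        |intros n Hn; assert (0 <= e n) by (apply Hbefore; lia); lra
        |intros n Hn; destruct (Rle_lt_dec (e n) 0); [lra|exfalso; apply Hno; exists m, n; tauto]])
        m). simpl in Hz. lra. }
    destruct Hex as [n1 [n2 [H12 [Hn1 Hn2]]]].
    exists (fun i => match i with O => 0%nat | 1%nat => n1 | 2%nat => n2
      | _ => S (Nat.max n2 l) end).
    assert (H3 : e (S (Nat.max n2 l)) = -1) by (apply E3; lia).
    assert (Hneg : forall x y, 0 < x -> y < 0 -> x * y < 0).
    { intros x y Hx Hy. assert (0 < x * - y) by (apply Rmult_lt_0_compat; lra). lra. }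
    intros [|[|[|i]]] Hi; try lia; (split; [|]).
    + destruct n1; [lra|lia].
    + apply Hneg; assumption.
    + exact H12.
    + rewrite Rmult_comm. apply Hneg; assumption.
    + lia.
    + apply Hneg; lra.
  - intros [n Hn].
    apply (pat_no_chain e 3 1 0 n); [lra|lia|apply bang_bang_pat; [lra|apply He]|exact Hn].
Qed.

Lemma locally_Ioo x a b : a < x < b -> locally x (fun y => a < y < b).
Proof. intros Hx. apply filter_and; [apply (open_gt a)|apply (open_lt b)]; lra. Qed.

(** If the value at [alpha] exceeded 1, it would still do so slightly to the left, giving a smaller
    triple zero. *)
Lemma alpha3_cmax alpha : is_alpha3 alpha -> 0 < alpha < 1 /\ cmax alpha alpha alpha = 1.
Proof.
  intros [[Ha [c [Hc Hz]]] Hmin]. split; [exact Ha|].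
  apply Rle_antisym.
  - apply Rnot_lt_le. intros Hgt.
    assert (Hloc : locally alpha (fun y => 1 < cmax y y y))
      by exact (cmax_continuous_triple alpha Ha _ (open_gt 1 _ Hgt)).
    destruct (filter_and _ _ Hloc (locally_Ioo alpha 0 1 Ha)) as [d Hd].
    set (x := alpha - d / 2). assert (Hd0 := cond_pos d).
    assert (Hx : ball alpha d x).
    { unfold ball; simpl; unfold AbsRing_ball, abs, minus, plus, opp; simpl. unfold x.
      apply Rabs_def1; lra. }
    destruct (Hd x Hx) as [H1 H2].
    destruct (in_B_of_cmax x x x H2 H2 H2 (Rlt_le _ _ H1)) as [f [Hf Vf]].
    assert (alpha <= x); [|unfold x in *; lra].
    apply Hmin. split; [exact H2|]. exists f. split; [exact Hf|].
    apply vanishes_triple_mult; assumption.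
  - apply cmax_ge_1 with c; try assumption.
    apply triple_mult_vanishes; [assumption|apply in_B_bounded, Hc|exact Hz].
Qed.

Lemma starstar_vanishes g m h : 0 < g -> g < m -> m < 1 ->
  starstar_solution g m h -> vanishes g m m h.
Proof.
  intros Hg Hgm Hm [Hh [_ [k [l [a [b [_ [_ [_ [HH [H1 [H2 H3]]]]]]]]]]]].
  apply vanishes_of_mult; try lra; [apply in_B_bounded, Hh|].
  intros x Hx. simpl.
  destruct (Req_EM_T g x) as [<-|Hgx]; destruct (Req_EM_T m _) as [Hmx|Hmx]; try lra.
  - intros [|j] Hj; [|lia]. simpl. rewrite HH by lra. exact H1.
  - subst x. intros [|[|j]] Hj; [| |lia].
    + simpl. rewrite HH by lra. exact H2.
    + simpl. rewrite <- H3. apply Derive_ext_loc.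
      apply filter_imp with (2 := locally_Ioo m (-1) 1 ltac:(lra)). exact HH.
  - intros j Hj. lia.
Qed.

Lemma extremal_starstar g m e : 0 < g -> g < m -> m < 1 ->
  extremal g m m e -> e 0%nat = 1 -> starstar_solution g m e.
Proof.
  intros Hg Hgm Hm He E0.
  assert (Hsc := extremal_sign_changes g m m e ltac:(lra) ltac:(lra) ltac:(lra) He).
  assert (Hmult := fun x Hx => extremal_mult g m m e x ltac:(lra) ltac:(lra) ltac:(lra) Hx He).
  destruct He as [[Hu [k [l [Hkl [E1 [E2 E3]]]]]] Ve].
  split; [split; [exact E0|exact Hu]|split; [split; [exact E0|split; [|exact Hsc]]|]].
  { exists k, l. auto. }
  assert (HH := bang_bang_H e k l Hkl E0 E1 E2 E3).
  exists k, l, (e k), (e l).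
  split; [exact Hkl|split; [apply Hu; lia|split; [apply Hu; lia|split; [exact HH|]]]].
  split; [|split].
  - rewrite <- HH by lra. destruct (Hmult g ltac:(lra)) as [Hz _].
    apply (Hz 0%nat). simpl. destruct (Req_EM_T g g); [lia|congruence].
  - rewrite <- HH by lra. destruct (Hmult m ltac:(lra)) as [Hz _].
    apply (Hz 0%nat). simpl. destruct (Req_EM_T m m); [|congruence].
    destruct (Req_EM_T g m); lia.
  - rewrite <- (Derive_ext_loc (PSeries e)).
    + destruct (Hmult m ltac:(lra)) as [Hz _].
      apply (Hz 1%nat). simpl. destruct (Req_EM_T m m); [|congruence].
      destruct (Req_EM_T g m); lia.
    + apply filter_imp with (2 := locally_Ioo m (-1) 1 ltac:(lra)). exact HH.
Qed.

Section Psi.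
Variable alpha : R.
Hypothesis Ha : 0 < alpha < 1.
Hypothesis Ha1 : cmax alpha alpha alpha = 1.

Definition psi_fun (g : R) : R :=
  epsilon (inhabits 0) (fun x => alpha < x < 1 /\ cmax g x x = 1).

Lemma psi_spec g : 1/2 < g < alpha -> alpha < psi_fun g < 1 /\ cmax g (psi_fun g) (psi_fun g) = 1.
Proof.
  intros Hg. unfold psi_fun.
  apply (epsilon_spec (inhabits 0) (fun x => alpha < x < 1 /\ cmax g x x = 1)).
  destruct (three_zeros_above_half g) as [y [Hy Hy1]]; [lra|].
  assert (Hlow : cmax g alpha alpha < 1) by (rewrite <- Ha1; apply cmax_lt1; lra).
  assert (Hya : alpha < y).
  { apply Rnot_le_lt. intros Hle.
    assert (cmax g y y <= cmax g alpha alpha) by (apply cmax_le; lra). lra. }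
  (* At [y] the value is only known to be at least 1; any larger point makes it strictly greater, so
     that the intermediate value theorem applies. *)
  set (z := (y + 1) / 2).
  assert (Hz : 1 < cmax g z z).
  { apply Rle_lt_trans with (1 := Hy1). apply cmax_lt_diag; unfold z; lra. }
  destruct (IVT_interv (fun x => cmax g x x - 1) alpha z) as [x [Hx Hx0]].
  - intros x Hx. apply continuity_pt_minus.
    + apply continuity_pt_filterlim. apply cmax_continuous_pair; unfold z in *; lra.
    + apply continuity_pt_const. intros ? ?; reflexivity.
  - unfold z; lra.
  - lra.
  - lra.
  - exists x. split; [|lra].
    split; [|unfold z in *; lra].
    destruct (Req_dec x alpha) as [->|]; lra.
Qed.

Lemma psi_gt g x : 1/2 < g < alpha -> 0 < x < 1 -> cmax g x x < 1 -> x < psi_fun g.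
Proof.
  intros Hg Hx H1. destruct (psi_spec g Hg) as [Hp Hp1].
  apply Rnot_le_lt. intros Hle.
  assert (cmax g (psi_fun g) (psi_fun g) <= cmax g x x) by (apply cmax_le; lra). lra.
Qed.

Lemma psi_lt g x : 1/2 < g < alpha -> 0 < x < 1 -> 1 < cmax g x x -> psi_fun g < x.
Proof.
  intros Hg Hx H1. destruct (psi_spec g Hg) as [Hp Hp1].
  apply Rnot_le_lt. intros Hle.
  assert (cmax g x x <= cmax g (psi_fun g) (psi_fun g)) by (apply cmax_le; lra). lra.
Qed.

Lemma psi_decreasing s t : 1/2 < s -> s < t -> t < alpha -> psi_fun t < psi_fun s.
Proof.
  intros Hs Hst Ht. destruct (psi_spec s) as [Hp Hp1]; [lra|].
  apply psi_lt; try lra. rewrite <- Hp1. apply cmax_lt1; lra.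
Qed.

Lemma cmax_eventually_lt g x : 0 < g < 1 -> 0 < x < 1 -> cmax g x x < 1 ->
  locally g (fun y => cmax y x x < 1).
Proof.
  intros Hg Hx H1. exact (cmax_continuous_point x x g Hx Hx Hg _ (open_lt 1 _ H1)).
Qed.

Lemma cmax_eventually_gt g x : 0 < g < 1 -> 0 < x < 1 -> 1 < cmax g x x ->
  locally g (fun y => 1 < cmax y x x).
Proof.
  intros Hg Hx H1. exact (cmax_continuous_point x x g Hx Hx Hg _ (open_gt 1 _ H1)).
Qed.

Lemma near_R x y (eps : posreal) : x - eps < y < x + eps -> ball x eps y.
Proof.
  intros Hy. unfold ball; simpl. unfold AbsRing_ball, abs, minus, plus, opp; simpl.
  apply Rabs_def1; lra.
Qed.

(** At [lo] and [hi], on either side of [psi_fun g], the value of [cmax] differs strictly from 1.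
    This persists for nearby first arguments, which traps [psi_fun y] between [lo] and [hi]. *)
Lemma psi_continuous g : 1/2 < g < alpha -> continuous psi_fun g.
Proof.
  intros Hg. apply filterlim_locally. intros eps.
  destruct (psi_spec g Hg) as [Hp Hp1]. assert (He := cond_pos eps).
  set (lo := Rmax alpha (psi_fun g - eps / 2)).
  set (hi := Rmin ((psi_fun g + 1) / 2) (psi_fun g + eps / 2)).
  assert (Hlo : alpha <= lo /\ psi_fun g - eps < lo /\ lo < psi_fun g).
  { unfold lo, Rmax; destruct Rle_dec; lra. }
  assert (Hhi : hi < psi_fun g + eps /\ psi_fun g < hi /\ hi < 1).
  { unfold hi, Rmin; destruct Rle_dec; lra. }
  assert (L1 : locally g (fun y => cmax y lo lo < 1)).
  { apply cmax_eventually_lt; try lra. rewrite <- Hp1. apply cmax_lt_diag; lra. }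
  assert (L2 : locally g (fun y => 1 < cmax y hi hi)).
  { apply cmax_eventually_gt; try lra. rewrite <- Hp1. apply cmax_lt_diag; lra. }
  apply filter_imp with (2 := filter_and _ _ (locally_Ioo g _ _ Hg) (filter_and _ _ L1 L2)).
  intros y [Hy [H1 H2]].
  assert (lo < psi_fun y) by (apply psi_gt; lra). assert (psi_fun y < hi) by (apply psi_lt; lra).
  apply near_R. lra.
Qed.

Hypothesis Ha2 : 1/2 < alpha.

(** At 1/2 itself [cmax] stays below 1 for every [lo < 1]; by continuity [psi_fun] then exceeds [lo]
    near 1/2. *)
Lemma psi_limit_half : filterlim psi_fun (at_right (1/2)) (locally 1).
Proof.
  apply filterlim_locally. intros eps. assert (He := cond_pos eps).
  set (lo := Rmax (1/2) (1 - eps / 2)).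
  assert (Hlo : 1/2 <= lo /\ 1 - eps < lo /\ lo < 1).
  { unfold lo, Rmax; destruct Rle_dec; lra. }
  assert (L1 : locally (1/2) (fun y => cmax y lo lo < 1)).
  { apply cmax_eventually_lt; try lra. apply cmax_half_lt_1; lra. }
  assert (L2 : locally (1/2) (fun y => 0 < y < alpha)) by (apply locally_Ioo; lra).
  apply filter_imp with (2 := filter_and _ _ L2 L1).
  intros y [Hy H1] Hy2.
  assert (Hp := psi_spec y ltac:(lra)).
  assert (lo < psi_fun y) by (apply psi_gt; lra).
  apply near_R. lra.
Qed.

Lemma psi_limit_alpha : filterlim psi_fun (at_left alpha) (locally alpha).
Proof.
  apply filterlim_locally. intros eps. assert (He := cond_pos eps).
  set (hi := Rmin ((alpha + 1) / 2) (alpha + eps / 2)).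
  assert (Hhi : hi < alpha + eps /\ alpha < hi /\ hi < 1).
  { unfold hi, Rmin; destruct Rle_dec; lra. }
  assert (L1 : locally alpha (fun y => 1 < cmax y hi hi)).
  { apply cmax_eventually_gt; try lra. rewrite <- Ha1. apply cmax_lt_diag; lra. }
  assert (L2 : locally alpha (fun y => 1/2 < y < 1)) by (apply locally_Ioo; lra).
  apply filter_imp with (2 := filter_and _ _ L2 L1).
  intros y [Hy H1] Hy2.
  assert (Hp := psi_spec y ltac:(lra)).
  assert (psi_fun y < hi) by (apply psi_lt; lra).
  apply near_R. lra.
Qed.

Lemma psi_extremal g : 1/2 < g < alpha ->
  exists e, extremal g (psi_fun g) (psi_fun g) e /\ e 0%nat = 1.
Proof.
  intros Hg. destruct (psi_spec g Hg) as [Hp Hp1]. rewrite <- Hp1. apply cmax_spec; lra.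
Qed.

(** Suppose [x < psi_fun g]. If [x <= g], three zeros lie below [alpha], where [cmax] is less than
    1. Otherwise [g] is one of the first two zeros, and raising the other to [x] gives
    [cmax g x x >= 1], contrary to strict monotonicity. *)
Lemma psi_lower_bound g c x : 1/2 < g < alpha -> in_B c -> PSeries c g = 0 ->
  is_xi 3 (PSeries c) x -> psi_fun g <= x.
Proof.
  intros Hg Hc H0 Hx. destruct (psi_spec g Hg) as [Hp Hp1].
  apply Rnot_lt_le. intros Hlt.
  destruct (xi3_vanishes c x Hc Hx ltac:(lra)) as [r [s [Hr [Hrs [Hsx [Vc Hzeros]]]]]].
  assert (H1 : 1 <= cmax r s x) by (apply cmax_ge_1 with c; try lra; assumption).
  destruct (Rle_lt_dec x g) as [Hxg|Hxg].
  - assert (cmax r s x <= cmax g g g) by (apply cmax_le; lra).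
    assert (cmax g g g < cmax alpha g g) by (apply cmax_lt1; lra).
    assert (cmax alpha g g <= cmax alpha alpha alpha) by (apply cmax_le; lra). lra.
  - assert (Hdiag : cmax g x x < cmax g (psi_fun g) (psi_fun g)) by (apply cmax_lt_diag; lra).
    destruct (Hzeros g ltac:(lra) H0) as [<-|<-].
    + assert (cmax g s x <= cmax g x x) by (apply cmax_le; lra). lra.
    + rewrite cmax_swap12 in H1 by lra.
      assert (cmax g r x <= cmax g x x) by (apply cmax_le; lra). lra.
Qed.

End Psi.

Theorem proposition2p5 (alpha3 : R) (Halpha3 : is_alpha3 alpha3) :
  exists psi : R -> R,
    (* (a) *)
    ((forall gamma, 1/2 < gamma < alpha3 ->
        is_minimum (xi3_values gamma) (psi gamma)) /\
     (forall gamma, 1/2 < gamma < alpha3 -> continuous psi gamma) /\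
     (forall s t, 1/2 < s -> s < t -> t < alpha3 -> psi t < psi s) /\
     filterlim psi (at_right (1/2)) (locally 1) /\
     filterlim psi (at_left alpha3) (locally alpha3)) /\
    (* (b) *)
    (forall gamma, 1/2 < gamma < alpha3 ->
       forall lambda, gamma < lambda < psi gamma ->
         ~ Omega_tilde_plus gamma lambda) /\
    (* (c) *)
    (forall gamma, 1/2 < gamma < alpha3 ->
       exists h : nat -> R,
         starstar_solution gamma (psi gamma) h /\
         forall h' : nat -> R,
           starstar_solution gamma (psi gamma) h' -> forall n, h' n = h n).
Proof.
  destruct (alpha3_cmax alpha3 Halpha3) as [Ha Ha1].
  assert (Ha2 : 1/2 < alpha3).
  { apply Rnot_le_lt. intros Hle.
    assert (H1 := cmax_half_lt_1 (1/2) ltac:(lra)).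
    assert (cmax alpha3 alpha3 alpha3 <= cmax (1/2) (1/2) (1/2)) by (apply cmax_le; lra). lra. }
  exists (psi_fun alpha3). split; [split; [|split; [|split; [|split]]]|split].
  - intros g Hg. destruct (psi_spec alpha3 Ha Ha1 g Hg) as [Hp _].
    destruct (psi_extremal alpha3 Ha Ha1 g Hg) as [e [He E0]]. split.
    + assert (Hs := extremal_starstar g (psi_fun alpha3 g) e
        ltac:(lra) ltac:(lra) ltac:(lra) He E0).
      exists e. split; [apply Hs|split].
      * destruct (extremal_mult g (psi_fun alpha3 g) (psi_fun alpha3 g) e g
          ltac:(lra) ltac:(lra) ltac:(lra) ltac:(lra) He) as [Hz _].
        apply (Hz 0%nat). simpl. destruct (Req_EM_T g g); [lia|congruence].
      * apply extremal_xi3 with g; try lra. exact He.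
    + intros x [c [Hc [H0 Hx]]]. apply psi_lower_bound with c; assumption.
  - intros g Hg. apply psi_continuous; assumption.
  - intros s t. apply psi_decreasing; assumption.
  - apply psi_limit_half; assumption.
  - apply psi_limit_alpha; assumption.
  - intros g Hg x Hx [_ [_ [_ [c [Hc [H0 [_ [y [Hy Hyx]]]]]]]]].
    assert (psi_fun alpha3 g <= y) by (apply psi_lower_bound with c; assumption). lra.
  - intros g Hg. destruct (psi_spec alpha3 Ha Ha1 g Hg) as [Hp _].
    destruct (psi_extremal alpha3 Ha Ha1 g Hg) as [e [He E0]].
    exists e. split; [apply extremal_starstar; try lra; assumption|].
    intros h Hh. assert (Hh0 := proj1 (proj1 Hh)).
    (* Any solution has constant term 1, the maximum for these zeros, so it coincides with the
       extremal series. *)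
    apply extremal_max with g (psi_fun alpha3 g) (psi_fun alpha3 g); try lra.
    + exact He.
    + apply starstar_vanishes; try lra. exact Hh.
    + exact (proj2 (proj1 Hh)).
Qed.
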